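(* (Bracket-rise theorem.) The obvious inclusion $\iota\colon\mathcal{D}^v(\uparrow)\to\mathcal{D}^{wt}(\uparrow)$ of arrow diagrams into w-Jacobi diagrams descends to the quotient $\mathcal{A}^w(\uparrow)$ and induces an isomorphism of vector spaces $\bar\iota\colon\mathcal{A}^w(\uparrow)\xrightarrow{\ \sim\ }\mathcal{A}^{wt}(\uparrow)$. Furthermore, the $\overrightarrow{AS}$ and $\overrightarrow{IHX}$ relations hold in $\mathcal{A}^{wt}(\uparrow)$.
   Context: All vector spaces are over $\mathbb{Q}$. **Arrow diagrams.** An arrow diagram is an oriented line (the skeleton) with finitely many arrows with distinct endpoints on it, up to orientation-preserving diffeomorphism; its degree is the number of arrows. $\mathcal{D}^v(\uparrow)$ is the graded space of formal linear combinations of arrow diagrams, and $\mathcal{A}^w(\uparrow)$ is its quotient by: - TC: exchanging two tails that are adjacent on the skeleton does not change the diagram. - $\overrightarrow{4T}$: for an arrow $\alpha$ and a second arrow $\beta$ with fixed tail, the sum of the two diagrams in which the head of $\beta$ is immediately before the tail of $\alpha$, respectively immediately before the head of $\alpha$, equals the sum of the two diagrams in which it is immediately after the tail of $\alpha$, respectively immediately after the head of $\alpha$. **w-Jacobi diagrams.** A w-Jacobi diagram (on a long line skeleton) is a connected graph consisting of an oriented, distinguished skeleton line; further directed edges (arrows); trivalent skeleton vertices, at which an arrow starts or ends on the skeleton; and trivalent internal vertices, at each of which exactly two arrows end and one arrow begins, with one of the two incoming arrows designated left ($l$) and the other right ($r$); the outgoing one is called $o$. Multiple edges, and bubbles (an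 arrow beginning and ending at the same vertex), are allowed. Diagrams are considered combinatorially. The degree is half the number of trivalent vertices (internal and skeleton). $\mathcal{D}^{wt}(\uparrow)$ is the graded space of formal linear combinations of w-Jacobi diagrams, and $\mathcal{A}^{wt}(\uparrow)$ is its quotient by TC (two tails adjacent on the skeleton may be exchanged) and: - $\overrightarrow{STU}_1$: if the outgoing edge of an internal vertex ends on the skeleton at a point $p$, the diagram equals (the diagram with this vertex and its outgoing edge removed and edges $l,r$ ending on the skeleton near $p$ in the order $l$, then $r$) minus (the same in the order $r$, then $l$). - $\overrightarrow{STU}_2$: if the right incoming edge $r$ of an internal vertex starts on the skeleton at $p$, the diagram equals (vertex and edge $r$ removed, with near $p$ the tail of $o$ followed by the head of $l$ along the skeleton) minus (the same with the head of $l$ followed by the tail of $o$). If instead the left incoming edge $l$ starts on the skeleton at $p$, the same holds with $l$ and $r$ exchanged and the overall sign reversed. **$\overrightarrow{AS}$ and $\overrightarrow{IHX}$.** $\overrightarrow{AS}$: exchanging the left/right designation at one internal vertex multiplies the diagram by $-1$. $\overrightarrow{IHX}$: writing $[p,q]$ for an internal vertex with left incoming edge $p$ and right incoming edge $q$ (denoting its outgoing edge), for three diagrams identical except for a part with three incoming edges $x,y,z$ and one outgoing edge, $[x,[y,z]]=[[x,y],z]-[[x,z],y]$. *)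

(* Defs.v *)
From HB Require Import structures.
From mathcomp Require Import all_boot all_order all_algebra ring_quotient.
From mathcomp Require Import zify.
From mathcomp Require Import boolp.
From mathcomp Require Import freeg.

Set Implicit Arguments.
Unset Strict Implicit.
Unset Printing Implicit Defensive.

Import GRing.Theory.
Local Open Scope ring_scope.
Local Open Scope quotient_scope.

Section Span.
Variables (R : nzRingType) (V : lmodType R).

(* The submodule generated by the set of vectors S. *)
Definition span_of (S : V -> Prop) : {pred V} :=
  fun x => `[< exists2 s : seq (R * V),
    (forall p, p \in s -> S p.2) & x = \sum_(p <- s) p.1 *: p.2 >].

Lemma span_of_submod S : submod_closed (span_of S).
Proof.
split=> [|a x y /asboolP[s Ss ->] /asboolP[t St ->]].
  by apply/asboolP; exists [::]; rewrite ?big_nil.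
apply/asboolP; exists ([seq (a * p.1, p.2) | p <- s] ++ t).
  by move=> p; rewrite mem_cat => /orP[/mapP[q /Ss Sq ->] | /St].
rewrite big_cat big_map scaler_sumr; congr (_ + _).
by apply: eq_bigr => p _; rewrite scalerA.
Qed.

HB.instance Definition _ S := GRing.isZmodClosed.Build V (span_of S)
  (GRing.submod_closedB (span_of_submod S)).
HB.instance Definition _ S := GRing.isScaleClosed.Build R V (span_of S)
  (GRing.subsemimod_closedZ (GRing.submod_closed_semi (span_of_submod S))).

Lemma mem_span_of (S : V -> Prop) x : S x -> x \in span_of S.
Proof.
move=> Sx; apply/asboolP; exists [:: (1, x)].
  by move=> p; rewrite inE => /eqP->.
by rewrite big_seq1 scale1r.
Qed.

End Span.

(* The quotient of V by the submodule generated by S.  The library gives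
   Quotient.quot a group structure only; scalar multiplication is added here. *)
Section LinearQuotient.
Variables (R : nzRingType) (V : lmodType R) (S : V -> Prop).

Definition lquot : Type := Quotient.quot (span_of S).

HB.instance Definition _ := GRing.Zmodule.on lquot.
HB.instance Definition _ : EqQuotient V (Quotient.equiv (span_of S)) lquot :=
  EqQuotient.on lquot.
HB.instance Definition _ :=
  ZmodQuotient.copy lquot (Quotient.quot (span_of S)).

Definition lquot_proj (x : V) : lquot := \pi_lquot x.

Lemma lquot_projP (x y : V) :
  reflect (lquot_proj x = lquot_proj y) (x - y \in span_of S).
Proof. by rewrite Quotient.idealrBE; apply: eqP. Qed.

Lemma lquot_proj_surj (u : lquot) : exists x, lquot_proj x = u.
Proof. by exists (repr u); exact: reprK. Qed.

Definition lquot_scale (a : R) (u : lquot) : lquot := lquot_proj (a *: repr u).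

Lemma lquot_proj_scale a x :
  lquot_scale a (lquot_proj x) = lquot_proj (a *: x).
Proof.
apply/lquot_projP; rewrite -scalerBr rpredZ //.
by apply/lquot_projP; exact: reprK.
Qed.

Fact lquot_proj_zmod : zmod_morphism lquot_proj.
Proof. by move=> x y; exact: raddfB. Qed.

HB.instance Definition _ :=
  GRing.isZmodMorphism.Build V lquot lquot_proj lquot_proj_zmod.

Fact lquot_scaleA a b u :
  lquot_scale a (lquot_scale b u) = lquot_scale (a * b) u.
Proof.
by case: (lquot_proj_surj u) => x <-; rewrite !lquot_proj_scale scalerA.
Qed.

Fact lquot_scale1 : left_id 1 lquot_scale.
Proof.
by move=> u; case: (lquot_proj_surj u) => x <-; rewrite lquot_proj_scale scale1r.
Qed.

Fact lquot_scaleDr : right_distributive lquot_scale +%R.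
Proof.
move=> a u v; case: (lquot_proj_surj u) (lquot_proj_surj v) => x <- [y <-].
by rewrite -raddfD !lquot_proj_scale scalerDr raddfD.
Qed.

Fact lquot_scaleDl u : {morph lquot_scale^~ u : a b / a + b}.
Proof.
move=> a b; case: (lquot_proj_surj u) => x <-.
by rewrite !lquot_proj_scale scalerDl raddfD.
Qed.

HB.instance Definition _ := GRing.Zmodule_isLmodule.Build R lquot
  lquot_scaleA lquot_scale1 lquot_scaleDr lquot_scaleDl.

Fact lquot_proj_scalable : scalable lquot_proj.
Proof. by move=> a x; rewrite -lquot_proj_scale. Qed.

HB.instance Definition _ :=
  GRing.isScalable.Build R V lquot *:%R lquot_proj lquot_proj_scalable.

End LinearQuotient.

Section LinearExtension.
Variables (R : nzRingType) (K : choiceType) (M : lmodType R) (f : K -> M).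

HB.instance Definition _ :=
  GRing.isZmodMorphism.Build {freeg K / R} M (fglift f) (lift_is_additive f).

Fact fglift_scalable : scalable (fglift f).
Proof.
move=> a x.
have -> : a *: x = \sum_(k <- dom x) << a * coeff k x *g k >> by [].
have -> : fglift f x = \sum_(k <- dom x) fglift f << coeff k x *g k >>.
  by rewrite -[x in LHS]freeg_sumE raddf_sum.
rewrite raddf_sum scaler_sumr; apply: eq_bigr => k _.
by rewrite /= !liftU scalerA.
Qed.

HB.instance Definition _ :=
  GRing.isScalable.Build R {freeg K / R} M *:%R (fglift f) fglift_scalable.

End LinearExtension.

Lemma bij_nat_inv (f : nat -> nat) : bijective f ->
  exists2 g, bijective g & cancel f g.
Proof. by case=> g fK gK; exists g => //; exists f. Qed.

(* A point of the skeleton, named by the arrow that starts (Tl) or ends (Hd)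
   there. *)
Inductive endpoint := Tl of nat | Hd of nat.

Definition endpoint_sum e : nat + nat :=
  match e with Tl a => inl a | Hd a => inr a end.
Definition sum_endpoint (s : nat + nat) :=
  match s with inl a => Tl a | inr a => Hd a end.
Lemma endpoint_sumK : cancel endpoint_sum sum_endpoint. Proof. by case. Qed.
HB.instance Definition _ := Countable.copy endpoint (can_type endpoint_sumK).

Definition tails (s : seq endpoint) : seq nat :=
  pmap (fun e => if e is Tl a then Some a else None) s.
Definition heads (s : seq endpoint) : seq nat :=
  pmap (fun e => if e is Hd a then Some a else None) s.

Definition rename_endpoint (f : nat -> nat) (e : endpoint) : endpoint :=
  match e with Tl a => Tl (f a) | Hd a => Hd (f a) end.

Lemma tails_rename f s : tails (map (rename_endpoint f) s) = map f (tails s).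
Proof. by elim: s => //= -[] a s /= ->. Qed.

Lemma heads_rename f s : heads (map (rename_endpoint f) s) = map f (heads s).
Proof. by elim: s => //= -[] a s /= ->. Qed.

Lemma rename_endpoint_id : rename_endpoint id =1 id. Proof. by case. Qed.

Lemma rename_endpoint_comp f g :
  rename_endpoint (f \o g) =1 rename_endpoint f \o rename_endpoint g.
Proof. by case. Qed.

Lemma rename_endpointK f g :
  cancel f g -> cancel (rename_endpoint f) (rename_endpoint g).
Proof. by move=> fK [] a /=; rewrite fK. Qed.

(* An arrow diagram with named arrows: the word of arrow endpoints read along
   the oriented skeleton, each name having exactly one tail and one head. *)
Record arrow_word := ArrowWord {
  skeleton :> seq endpoint;
  _ : uniq (tails skeleton) && perm_eq (tails skeleton) (heads skeleton) }.
HB.instance Definition _ := [isSub for skeleton].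
HB.instance Definition _ := [Choice of arrow_word by <:].

Definition arrow_iso (D E : arrow_word) : bool :=
  `[< exists2 f : nat -> nat, bijective f &
      map (rename_endpoint f) D = E :> seq endpoint >].

Fact arrow_iso_equiv : equiv_class_of arrow_iso.
Proof.
have sym D E : arrow_iso D E -> arrow_iso E D.
  case/asboolP=> f /bij_nat_inv[g bg fK] fD; apply/asboolP; exists g => //.
  by rewrite -fD (mapK (rename_endpointK fK)).
split=> [D | D E | E D F].
- apply/asboolP; exists id; first by exists id.
  by rewrite (eq_map rename_endpoint_id) map_id.
- by apply/idP/idP; exact: sym.
- move=> /asboolP[f bf fD] /asboolP[g bg gE]; apply/asboolP; exists (g \o f).
    exact: bij_comp.
  by rewrite (eq_map (rename_endpoint_comp g f)) map_comp fD.
Qed.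
Canonical arrow_iso_equivrel := EquivRelPack arrow_iso_equiv.
Canonical arrow_iso_encmod := defaultEncModRel arrow_iso.

(* Arrow diagrams proper: named diagrams up to renaming of the arrows. *)
Definition arrow_diagram := {eq_quot arrow_iso}.
HB.instance Definition _ := EqQuotient.on arrow_diagram.
HB.instance Definition _ := Choice.on arrow_diagram.

Definition arrow_degree (D : arrow_word) : nat := size (tails D).

Definition Dv : lmodType rat := {freeg arrow_diagram / rat}.

Definition arrow_gen (D : arrow_word) : Dv := << \pi_arrow_diagram D >>.

(* An internal vertex, given by the names of its left and right incoming edges
   and of its outgoing edge. *)
Record ivertex := IVertex { inl_ : nat; inr_ : nat; out_ : nat }.

Definition ivertex_tuple v := (inl_ v, inr_ v, out_ v).
Definition tuple_ivertex (t : nat * nat * nat) := IVertex t.1.1 t.1.2 t.2.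
Lemma ivertex_tupleK : cancel ivertex_tuple tuple_ivertex. Proof. by case. Qed.
HB.instance Definition _ := Countable.copy ivertex (can_type ivertex_tupleK).

Definition rename_ivertex (f : nat -> nat) (v : ivertex) : ivertex :=
  IVertex (f (inl_ v)) (f (inr_ v)) (f (out_ v)).

Lemma rename_ivertex_id : rename_ivertex id =1 id. Proof. by case. Qed.

Lemma rename_ivertex_comp f g :
  rename_ivertex (f \o g) =1 rename_ivertex f \o rename_ivertex g.
Proof. by case. Qed.

Lemma rename_ivertexK f g :
  cancel f g -> cancel (rename_ivertex f) (rename_ivertex g).
Proof. by move=> fK [a b c]; rewrite /rename_ivertex /= !fK. Qed.

(* A skeleton word together with a list of internal vertices. *)
Definition jacobi_code : Type := (seq endpoint * seq ivertex)%type.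

Definition jtails (c : jacobi_code) : seq nat := tails c.1 ++ map out_ c.2.
Definition jheads (c : jacobi_code) : seq nat :=
  heads c.1 ++ map inl_ c.2 ++ map inr_ c.2.

Definition jacobi_wf (c : jacobi_code) : bool :=
  uniq (jtails c) && perm_eq (jtails c) (jheads c).

(* A w-Jacobi diagram with named edges.  Every edge has one tail and one head;
   the tail may be the output and the head an input of the same vertex.  That
   the graph is connected follows, see jacobi_connected. *)
Record jacobi := Jacobi { jacobi_val :> jacobi_code; _ : jacobi_wf jacobi_val }.
HB.instance Definition _ := [isSub for jacobi_val].
HB.instance Definition _ := [Choice of jacobi by <:].

(* The internal vertices are unordered, whence the permutation. *)
Definition jacobi_iso (D E : jacobi) : bool :=
  `[< exists2 f : nat -> nat, bijective f &
      map (rename_endpoint f) (jacobi_val D).1 = (jacobi_val E).1 /\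
      perm_eq (map (rename_ivertex f) (jacobi_val D).2) (jacobi_val E).2 >].

Fact jacobi_iso_equiv : equiv_class_of jacobi_iso.
Proof.
have sym D E : jacobi_iso D E -> jacobi_iso E D.
  case/asboolP=> f /bij_nat_inv[g bg fK] [fD fV]; apply/asboolP.
  exists g => //; split; first by rewrite -fD (mapK (rename_endpointK fK)).
  rewrite perm_sym -[(jacobi_val D).2](mapK (rename_ivertexK fK)).
  exact: perm_map.
split=> [D | D E | E D F].
- apply/asboolP; exists id; first by exists id.
  by rewrite (eq_map rename_endpoint_id) (eq_map rename_ivertex_id) !map_id.
- by apply/idP/idP; exact: sym.
- move=> /asboolP[f bf [fD fV]] /asboolP[g bg [gE gW]]; apply/asboolP.
  exists (g \o f); first exact: bij_comp.
  rewrite (eq_map (rename_endpoint_comp g f)) map_comp fD; split=> //.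
  rewrite (eq_map (rename_ivertex_comp g f)) map_comp.
  by apply: perm_trans gW; exact: perm_map.
Qed.
Canonical jacobi_iso_equivrel := EquivRelPack jacobi_iso_equiv.
Canonical jacobi_iso_encmod := defaultEncModRel jacobi_iso.

Definition jacobi_diagram := {eq_quot jacobi_iso}.
HB.instance Definition _ := EqQuotient.on jacobi_diagram.
HB.instance Definition _ := Choice.on jacobi_diagram.

Definition jacobi_degree (D : jacobi) : nat :=
  (size (jacobi_val D).1 + size (jacobi_val D).2)./2.

Definition Dwt : lmodType rat := {freeg jacobi_diagram / rat}.

Definition jacobi_gen (D : jacobi) : Dwt := << \pi_jacobi_diagram D >>.

Section Connectedness.
Variable D : jacobi.
Let m := size (jacobi_val D).2.
Let vtx (i : 'I_m) := tnth (in_tuple (jacobi_val D).2) i.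

(* The node None is the whole skeleton line. *)
Definition node_tails (u : option 'I_m) : seq nat :=
  if u is Some i then [:: out_ (vtx i)] else tails (jacobi_val D).1.
Definition node_heads (u : option 'I_m) : seq nat :=
  if u is Some i then [:: inl_ (vtx i); inr_ (vtx i)]
  else heads (jacobi_val D).1.

Definition joined : rel (option 'I_m) := fun u v =>
  has (mem (node_heads v)) (node_tails u) ||
  has (mem (node_heads u)) (node_tails v).

Lemma jacobi_connected (u v : option 'I_m) : connect joined u v.
Proof.
have jsym : connect_sym joined.
  by apply: sym_connect_sym => x y; rewrite /joined orbC.
suff cN x : connect joined None x.
  by apply: connect_trans (cN v); rewrite jsym.
pose C := [pred i : 'I_m | ~~ connect joined None (Some i)].
suff /card0_eq C0 : #|C| = 0%N.
  by case: x => [i|]; [have /negbFE := C0 i | exact: connect0].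
have vtxE (g : ivertex -> nat) :
    map g (jacobi_val D).2 = map (g \o vtx) (enum 'I_m).
  by rewrite map_comp map_tnth_enum.
have subC (g : ivertex -> nat) :
    subseq (map (g \o vtx) (enum C)) (map g (jacobi_val D).2).
  have -> : enum C = filter (mem C) (enum 'I_m) by rewrite [in RHS]enumT.
  by rewrite vtxE map_subseq // filter_subseq.
have /andP[Ut pth] := valP D.
pose L := map (inl_ \o vtx) (enum C) ++ map (inr_ \o vtx) (enum C).
have Lh : subseq L (jheads D).
  rewrite /jheads; apply: subseq_trans (suffix_subseq _ _).
  by apply: cat_subseq; exact: subC.
have UL : uniq L by apply: subseq_uniq Lh _; rewrite -(perm_uniq pth).
suff LT : {subset L <= map (out_ \o vtx) (enum C)}.
  have := uniq_leq_size UL LT; rewrite size_cat !size_map -cardE.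
  by rewrite -[leqRHS]addn0 leq_add2l leqn0 => /eqP.
move=> h hL; have [i iC hi] : exists2 i, i \in C & h \in node_heads (Some i).
  move: hL; rewrite mem_cat => /orP[] /mapP[i]; rewrite mem_enum => iC ->.
    by exists i; rewrite // !inE eqxx.
  by exists i; rewrite // !inE eqxx orbT.
have : h \in jtails D by rewrite (perm_mem pth) (mem_subseq Lh).
have notj w : h \in node_tails w -> ~~ connect joined None w.
  move=> hw; apply: contra iC => /connect_trans; apply; apply: connect1.
  by apply/orP; left; apply/hasP; exists h.
rewrite /jtails mem_cat => /orP[/(notj None) | ]; first by rewrite connect0.
rewrite vtxE => /mapP[j _ hj]; apply/mapP; exists j; rewrite // mem_enum.
by apply: (notj (Some j)); rewrite inE; exact/eqP.
Qed.
End Connectedness.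

Fact jacobi_of_arrow_wf (D : arrow_word) : jacobi_wf (skeleton D, [::]).
Proof. by rewrite /jacobi_wf /jtails /jheads /= !cats0; exact: (valP D). Qed.

Definition jacobi_of_arrow (D : arrow_word) : jacobi :=
  Jacobi (jacobi_of_arrow_wf D).

Definition incl (d : arrow_diagram) : jacobi_diagram :=
  \pi_jacobi_diagram (jacobi_of_arrow (repr d)).

Lemma incl_pi (D : arrow_word) :
  incl (\pi_arrow_diagram D) = \pi_jacobi_diagram (jacobi_of_arrow D).
Proof.
apply/eqmodP; have /eqmodP/asboolP[f bf fD] : repr (\pi_arrow_diagram D) = D
  %[mod arrow_diagram] by rewrite reprK.
by apply/asboolP; exists f.
Qed.

Lemma incl_inj : injective incl.
Proof.
move=> d e; rewrite -[d]reprK -[e]reprK !incl_pi => /eqmodP/asboolP[f bf [fD _]].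
by apply/eqmodP/asboolP; exists f.
Qed.

Lemma degree_jacobi_of_arrow (D : arrow_word) :
  jacobi_degree (jacobi_of_arrow D) = arrow_degree D.
Proof.
rewrite /jacobi_degree /arrow_degree /= addn0.
have -> : size (skeleton D) = (size (tails D) + size (heads D))%N.
  by elim: (skeleton D) => //= -[] a s /= ->; rewrite ?addSn ?addnS.
have /andP[_ /perm_size <-] := valP D.
by rewrite addnn doubleK.
Qed.

Definition iota_vw : Dv -> Dwt := fglift (fun d => << incl d >> : Dwt).
HB.instance Definition _ := GRing.Linear.on iota_vw.

Lemma iota_vw_gen (D : arrow_word) :
  iota_vw (arrow_gen D) = jacobi_gen (jacobi_of_arrow D).
Proof. by rewrite /iota_vw /arrow_gen liftU scale1r incl_pi. Qed.

(* In w_4T the arrow a is alpha and b is beta; x and y are the two endpoints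
   of alpha, in the order in which they occur on the skeleton. *)
Inductive rel_w : Dv -> Prop :=
| w_TC s1 s2 a b (D E : arrow_word) :
    skeleton D = s1 ++ [:: Tl a; Tl b] ++ s2 ->
    skeleton E = s1 ++ [:: Tl b; Tl a] ++ s2 ->
    rel_w (arrow_gen D - arrow_gen E)
| w_4T s1 s2 s3 a b x y (D1 D2 D3 D4 : arrow_word) :
    perm_eq [:: x; y] [:: Tl a; Hd a] ->
    skeleton D1 = s1 ++ [:: Hd b; x] ++ s2 ++ [:: y] ++ s3 ->
    skeleton D2 = s1 ++ [:: x] ++ s2 ++ [:: Hd b; y] ++ s3 ->
    skeleton D3 = s1 ++ [:: x; Hd b] ++ s2 ++ [:: y] ++ s3 ->
    skeleton D4 = s1 ++ [:: x] ++ s2 ++ [:: y; Hd b] ++ s3 ->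
    rel_w (arrow_gen D1 + arrow_gen D2 - (arrow_gen D3 + arrow_gen D4)).

(* In each constructor the internal vertex involved is listed first, which is no
   restriction: diagrams are taken up to permutation of the vertex list.  In
   wt_STU2r one may have l = o, and in wt_STU2l r = o (a bubble). *)
Inductive rel_wt : Dwt -> Prop :=
| wt_TC s1 s2 V a b (D E : jacobi) :
    jacobi_val D = (s1 ++ [:: Tl a; Tl b] ++ s2, V) ->
    jacobi_val E = (s1 ++ [:: Tl b; Tl a] ++ s2, V) ->
    rel_wt (jacobi_gen D - jacobi_gen E)
| wt_STU1 s1 s2 V l r o (D E F : jacobi) :
    jacobi_val D = (s1 ++ [:: Hd o] ++ s2, IVertex l r o :: V) ->
    jacobi_val E = (s1 ++ [:: Hd l; Hd r] ++ s2, V) ->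
    jacobi_val F = (s1 ++ [:: Hd r; Hd l] ++ s2, V) ->
    rel_wt (jacobi_gen D - (jacobi_gen E - jacobi_gen F))
| wt_STU2r s1 s2 V l r o (D E F : jacobi) :
    jacobi_val D = (s1 ++ [:: Tl r] ++ s2, IVertex l r o :: V) ->
    jacobi_val E = (s1 ++ [:: Tl o; Hd l] ++ s2, V) ->
    jacobi_val F = (s1 ++ [:: Hd l; Tl o] ++ s2, V) ->
    rel_wt (jacobi_gen D - (jacobi_gen E - jacobi_gen F))
| wt_STU2l s1 s2 V l r o (D E F : jacobi) :
    jacobi_val D = (s1 ++ [:: Tl l] ++ s2, IVertex l r o :: V) ->
    jacobi_val E = (s1 ++ [:: Tl o; Hd r] ++ s2, V) ->
    jacobi_val F = (s1 ++ [:: Hd r; Tl o] ++ s2, V) ->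
    rel_wt (jacobi_gen D - (- (jacobi_gen E - jacobi_gen F))).

Definition Aw : lmodType rat := lquot rel_w.
Definition Awt : lmodType rat := lquot rel_wt.

Definition class_w : {linear Dv -> Aw} := lquot_proj rel_w.
Definition class_wt : {linear Dwt -> Awt} := lquot_proj rel_wt.

(* The codes occurring in the relations are well formed as soon as the first
   of them is. *)
Lemma tails_cat s t : tails (s ++ t) = tails s ++ tails t.
Proof. exact: pmap_cat. Qed.

Lemma heads_cat s t : heads (s ++ t) = heads s ++ heads t.
Proof. exact: pmap_cat. Qed.

Lemma jacobi_wfP (c : jacobi_code) :
  reflect (forall x, count_mem x (jtails c) = count_mem x (jheads c) /\
                     (count_mem x (jtails c) <= 1)%N)
          (jacobi_wf c).
Proof.
apply: (iffP andP) => [[Ut /permP pth] x | H].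
  by rewrite pth; split=> //; rewrite -pth count_uniq_mem // leq_b1.
split; last by apply/allP => x _ /=; case: (H x) => ->.
apply: count_mem_uniq => x; case: (H x) => _.
by rewrite -has_pred1 has_count; case: count => [|[]].
Qed.

Ltac wf_count :=
  rewrite /jtails /jheads ?tails_cat ?heads_cat /= ?tails_cat ?heads_cat /=
          ?count_cat /= ?count_cat /=; lia.

Lemma arrow_wf_perm (s t : seq endpoint) : perm_eq s t ->
  uniq (tails s) && perm_eq (tails s) (heads s) =
  uniq (tails t) && perm_eq (tails t) (heads t).
Proof.
move=> st; have pt : perm_eq (tails s) (tails t) by exact: perm_pmap.
have ph : perm_eq (heads s) (heads t) by exact: perm_pmap.
by rewrite (perm_uniq pt) (permPl pt) (permPr ph).
Qed.

Lemma jacobi_wf_perm (s t : seq endpoint) V : perm_eq s t ->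
  jacobi_wf (s, V) = jacobi_wf (t, V).
Proof.
move=> st; rewrite /jacobi_wf /jtails /jheads /=.
have pt : perm_eq (tails s ++ map out_ V) (tails t ++ map out_ V).
  by rewrite perm_cat2r; exact: perm_pmap.
rewrite (perm_uniq pt) (permPl pt); congr (_ && _); apply: (permPr _).
by rewrite perm_cat2r; exact: perm_pmap.
Qed.

Lemma jacobi_wf_STU1 s1 s2 V l r o :
  jacobi_wf (s1 ++ [:: Hd o] ++ s2, IVertex l r o :: V) ->
  jacobi_wf (s1 ++ [:: Hd l; Hd r] ++ s2, V).
Proof. by move=> /jacobi_wfP H; apply/jacobi_wfP => x; move: (H x); wf_count. Qed.

Lemma jacobi_wf_STU2r s1 s2 V l r o :
  jacobi_wf (s1 ++ [:: Tl r] ++ s2, IVertex l r o :: V) ->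
  jacobi_wf (s1 ++ [:: Tl o; Hd l] ++ s2, V).
Proof. by move=> /jacobi_wfP H; apply/jacobi_wfP => x; move: (H x); wf_count. Qed.

Lemma jacobi_wf_STU2l s1 s2 V l r o :
  jacobi_wf (s1 ++ [:: Tl l] ++ s2, IVertex l r o :: V) ->
  jacobi_wf (s1 ++ [:: Tl o; Hd r] ++ s2, V).
Proof. by move=> /jacobi_wfP H; apply/jacobi_wfP => x; move: (H x); wf_count. Qed.

Lemma jacobi_wf_AS s V l r o :
  jacobi_wf (s, IVertex l r o :: V) -> jacobi_wf (s, IVertex r l o :: V).
Proof. by move=> /jacobi_wfP H; apply/jacobi_wfP => x; move: (H x); wf_count. Qed.

Lemma jacobi_wf_IHX s V x y z e o :
  jacobi_wf (s, [:: IVertex y z e, IVertex x e o & V]) ->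
  jacobi_wf (s, [:: IVertex x y e, IVertex e z o & V]) /\
  jacobi_wf (s, [:: IVertex x z e, IVertex e y o & V]).
Proof.
by move=> /jacobi_wfP H; split; apply/jacobi_wfP => t; move: (H t); wf_count.
Qed.

(* Main.v *)
From HB Require Import structures.
Require Import Defs.
From mathcomp Require Import all_boot all_order all_algebra.
From mathcomp Require Import zify boolp freeg.

(* The inverse of the map induced by iota removes internal vertices one at a time:
   a vertex joined to the skeleton by an edge is replaced, as STU prescribes, by a
   commutator of two skeleton ends.  There is always such a vertex, since each
   vertex has one more incoming than outgoing edge.  The result does not depend on
   the order of removal, by induction on the number of vertices.  Removals of
   different vertices commute, so two legs of the same vertex can be compared
   through a leg of another vertex.  If no other vertex has a leg, counting leaves
   two cases: a single Y, where the claim is 4T, and a vertex feeding a bubble,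
   where both sides vanish because a head slides across an isolated arrow.  TC for
   the resulting map follows the same pattern; AS and IHX become antisymmetry and
   the Jacobi identity for commutators of words. *)

Set Implicit Arguments.
Unset Strict Implicit.
Unset Printing Implicit Defensive.

Import GRing.Theory.
Local Open Scope ring_scope.
Local Open Scope quotient_scope.

(** Both directions rest on the same picture. A Y-shaped diagram can be removed through any of its
    three legs; that the results agree in [Aw] is 4T, and conversely 4T holds in [Awt] because STU
    applies to a Y through different legs. So the relation that makes the inverse well defined is
    also the one that lets the inclusion descend. STU does not treat edge names evenly: removing one
    vertex through different legs leaves different names on the same arrow. Such results are
    compared as named words and matched by a transposition of two names, which is why invariance
    under renaming is needed. AS and IHX are proved for the values in [Aw] and then carried to [Awt]
    by the induced map. *)

(** * Half-edges and well-formed codes *)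

Definition partner (e : endpoint) : endpoint :=
  match e with Tl a => Hd a | Hd a => Tl a end.

Lemma partnerK : involutive partner. Proof. by case. Qed.

Lemma partner_neq e : partner e != e. Proof. by case: e. Qed.

Definition vends (v : ivertex) : seq endpoint :=
  [:: Tl (out_ v); Hd (inl_ v); Hd (inr_ v)].

Definition ends (s : seq endpoint) (V : seq ivertex) : seq endpoint :=
  s ++ flatten (map vends V).

Lemma Tl_eqE a b : (Tl a == Tl b) = (a == b).
Proof. by apply/eqP/eqP => [[]|->]. Qed.

Lemma Hd_eqE a b : (Hd a == Hd b) = (a == b).
Proof. by apply/eqP/eqP => [[]|->]. Qed.

Definition end_eqE := (Tl_eqE, Hd_eqE).

Lemma count_tails a s : count_mem a (tails s) = count_mem (Tl a) s.
Proof. by elim: s => //= -[] b s /= IH; rewrite ?IH ?end_eqE. Qed.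

Lemma count_heads a s : count_mem a (heads s) = count_mem (Hd a) s.
Proof. by elim: s => //= -[] b s /= IH; rewrite ?IH ?end_eqE. Qed.

Lemma count_jtails a s V : count_mem a (jtails (s, V)) =
  count_mem (Tl a) (ends s V).
Proof.
rewrite /jtails /ends !count_cat count_tails /=; congr (_ + _)%N.
by elim: V => //= v V ->; rewrite end_eqE.
Qed.

Lemma count_jheads a s V : count_mem a (jheads (s, V)) =
  count_mem (Hd a) (ends s V).
Proof.
rewrite /jheads /ends !count_cat count_heads /=; congr (_ + _)%N.
elim: V => //= v V; rewrite !end_eqE => <-; lia.
Qed.

(* The graph encoded by (s, V) has no dangling or repeated edge exactly when the
   ends at its trivalent vertices are pairwise distinct and closed under
   partner. *)
Lemma wfP s V :
  reflect (uniq (ends s V) /\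
           forall e, (partner e \in ends s V) = (e \in ends s V))
          (jacobi_wf (s, V)).
Proof.
apply: (iffP (jacobi_wfP _)) => [H | [U C] a].
  have le1 e : (count_mem e (ends s V) <= 1)%N.
    case: e => a; have [] := H a; first by rewrite -count_jtails.
    by rewrite -count_jheads => <-.
  split.
    apply: count_mem_uniq => e; have := le1 e.
    by rewrite -has_pred1 has_count; case: count => [|[]].
  have TH a : (Hd a \in ends s V) = (Tl a \in ends s V).
    have [+ _] := H a; rewrite count_jtails count_jheads.
    by rewrite -!has_pred1 !has_count => ->.
  by case=> a /=; rewrite TH.
rewrite count_jtails count_jheads !count_uniq_mem // -(C (Tl a)) /=.
by case: (_ \in _).
Qed.

Lemma wf_arrow s :
  jacobi_wf (s, [::]) = uniq (tails s) && perm_eq (tails s) (heads s).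
Proof. by rewrite /jacobi_wf /jtails /jheads /= !cats0. Qed.

Lemma ends_perm s s' V V' :
  perm_eq s s' -> perm_eq V V' -> perm_eq (ends s V) (ends s' V').
Proof.
by move=> ps pV; rewrite /ends; apply: perm_cat => //;
  apply/perm_flatten/perm_map.
Qed.

Lemma wf_perm s s' V V' : perm_eq s s' -> perm_eq V V' ->
  jacobi_wf (s, V) = jacobi_wf (s', V').
Proof.
move=> ps pV; have p := ends_perm ps pV.
apply/wfP/wfP; rewrite (perm_uniq p) => -[U C]; split=> // e.
  by rewrite -!(perm_mem p).
by rewrite !(perm_mem p).
Qed.

(** * Substitution of words for points of the skeleton *)

Definition sub (x : endpoint) (w s : seq endpoint) : seq endpoint :=
  flatten (map (fun e => if e == x then w else [:: e]) s).

Lemma sub_cat x w s t : sub x w (s ++ t) = sub x w s ++ sub x w t.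
Proof. by rewrite /sub map_cat flatten_cat. Qed.

Lemma sub_cons x w e s :
  sub x w (e :: s) = (if e == x then w else [:: e]) ++ sub x w s.
Proof. by []. Qed.

Lemma sub_id x w s : x \notin s -> sub x w s = s.
Proof.
elim: s => //= e s IH; rewrite inE negb_or => /andP[xe /IH IHs].
by rewrite /sub /= eq_sym (negbTE xe) /= -/(sub _ _ _) IHs.
Qed.

Lemma sub_split x w s1 s2 : x \notin s1 -> x \notin s2 ->
  sub x w (s1 ++ x :: s2) = s1 ++ w ++ s2.
Proof.
move=> x1 x2; rewrite sub_cat sub_id // /sub /= eqxx -/(sub x w s2).
by rewrite sub_id.
Qed.

Lemma count_sub p x w s :
  (count p (sub x w s) + count_mem x s * p x =
   count p s + count_mem x s * count p w)%N.
Proof.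
elim: s => //= e s IH; rewrite /sub /= -/(sub x w s) count_cat.
case: (eqVneq e x) => [-> | _] /=; lia.
Qed.

Lemma mem_sub e x w s : x \in s ->
  (e \in sub x w s) = (e \in w) || ((e != x) && (e \in s)).
Proof.
move=> xs; apply/flatten_mapP/orP => [[f fs] | ].
  case: (eqVneq f x) => [_ | fx]; [by left | rewrite inE => /eqP->; right].
  by rewrite fx.
case=> [ew | /andP[ex es]]; first by exists x; rewrite ?eqxx.
by exists e; rewrite // (negbTE ex) inE.
Qed.

Lemma sub_notin e x w s : x \in s -> e \notin w -> e \notin s ->
  e \notin sub x w s.
Proof. by move=> xs ew es; rewrite mem_sub // negb_or ew negb_and es orbT. Qed.

Lemma perm_sub x w w' s : perm_eq w w' -> perm_eq (sub x w s) (sub x w' s).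
Proof.
move=> ww; elim: s => //= e s IH; rewrite /sub /= -!/(sub _ _ s).
by apply: perm_cat => //; case: ifP.
Qed.

Lemma uniq_mid (T : eqType) (x y : T) s1 s2 : uniq (s1 ++ [:: x; y] ++ s2) ->
  [/\ x != y, x \notin s1, x \notin s2, y \notin s1 & y \notin s2].
Proof.
rewrite (perm_uniq (permEl (perm_catCA s1 [:: x; y] s2))) /=.
rewrite !inE !mem_cat !negb_or.
by move=> /and3P[/and3P[-> -> ->] /andP[-> ->] _].
Qed.

Lemma sub_flatten x w (f : endpoint -> seq endpoint) s :
  sub x w (flatten (map f s)) = flatten (map (fun e => sub x w (f e)) s).
Proof. by elim: s => //= e s IH; rewrite sub_cat IH. Qed.

Lemma sub1E x w e : sub x w [:: e] = if e == x then w else [:: e].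
Proof. by rewrite /sub /= cats0. Qed.

Lemma sub_sub x w y u s : x \notin s -> sub x w (sub y u s) =
  sub y (sub x w u) s.
Proof.
move=> xs; rewrite [sub y u s]/sub sub_flatten; congr flatten.
apply/eq_in_map => e es; case: eqP => // _.
by rewrite sub_id // inE; apply: contraNneq xs => ->.
Qed.

(** The source of the commutation of removals: neither inserted word contains the point at which the
    other one is inserted. *)
Lemma subC x w y u s : x != y -> x \notin u -> y \notin w ->
  sub x w (sub y u s) = sub y u (sub x w s).
Proof.
move=> xy xu yw; rewrite [sub x w s in RHS]/sub [sub y u s in LHS]/sub
  !sub_flatten.
congr flatten; apply: eq_map => e.
case: (eqVneq e y) => [-> | ey]; last first.
  rewrite sub1E; case: (eqVneq e x) => [_ | _]; first by rewrite sub_id.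
  by rewrite sub1E (negbTE ey).
by rewrite eq_sym (negbTE xy) sub1E eqxx sub_id.
Qed.

Lemma map_rename_sub f x w s : injective f ->
  map (rename_endpoint f) (sub x w s) =
  sub (rename_endpoint f x) (map (rename_endpoint f) w)
      (map (rename_endpoint f) s).
Proof.
move=> fI; have rI : injective (rename_endpoint f).
  by move=> [] a [] b //= [] /fI->.
rewrite /sub map_flatten -!map_comp; congr flatten; apply: eq_map => e /=.
by rewrite (inj_eq rI); case: ifP.
Qed.

(* leg v x y z: an edge joining v to the skeleton has the skeleton end x, and
   removing v replaces x by yz - zy.  In the cyclic order (o, l, r) of the edges
   at v, the ends y and z are those of the edges following the one of x; this
   puts the sign of STU2 for left edges into the order of y and z. *)
Inductive leg : ivertex -> endpoint -> endpoint -> endpoint -> Prop :=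
| leg_out l r o : leg (IVertex l r o) (Hd o) (Hd l) (Hd r)
| leg_left l r o : leg (IVertex l r o) (Tl l) (Hd r) (Tl o)
| leg_right l r o : leg (IVertex l r o) (Tl r) (Tl o) (Hd l).

Lemma leg_perm v x y z : leg v x y z -> perm_eq [:: partner x; y; z] (vends v).
Proof. by case=> l r o; apply/permP => p /=; rewrite /vends /=; lia. Qed.

Lemma legP v e : e \in vends v -> exists y z, leg v (partner e) y z.
Proof.
case: v => l r o; rewrite !inE => /or3P[] /eqP-> /=.
- by exists (Hd l), (Hd r); constructor.
- by exists (Hd r), (Tl o); constructor.
- by exists (Tl o), (Hd l); constructor.
Qed.

(** Only [leg_left] and [leg_right] can share a skeleton end, namely when l = r, and distinct
    half-edges at [v] exclude this. *)
Lemma leg_fun v x y z y' z' : uniq (vends v) ->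
  leg v x y z -> leg v x y' z' -> y = y' /\ z = z'.
Proof.
case: v => l r o; rewrite /= !inE !end_eqE /= andbT => lr H1 H2.
inversion H1; subst; inversion H2; subst => //; by rewrite eqxx in lr.
Qed.

Lemma leg_rename f v x y z : leg v x y z ->
  leg (rename_ivertex f v) (rename_endpoint f x) (rename_endpoint f y)
      (rename_endpoint f z).
Proof. by case=> l r o; constructor. Qed.

Lemma flatten_vends v V :
  flatten (map vends (v :: V)) = vends v ++ flatten (map vends V).
Proof. by []. Qed.

Lemma uniq_vends s V v : jacobi_wf (s, V) -> v \in V -> uniq (vends v).
Proof.
move=> /wfP[+ _] vV; rewrite /ends cat_uniq => /and3P[_ _ U].
apply: subseq_uniq U; elim: V vV => // w V IH.
rewrite inE flatten_vends => /orP[/eqP<-|/IH].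
  exact: prefix_subseq.
by move=> H; apply: (subseq_trans H); exact: suffix_subseq.
Qed.

Lemma mem_ends_vends s V v e : v \in V -> e \in vends v -> e \in ends s V.
Proof.
by move=> vV ev; rewrite mem_cat; apply/orP; right; apply/flatten_mapP;
  exists v.
Qed.

Lemma ends_disjoint s V v e : jacobi_wf (s, V) -> v \in V -> e \in vends v ->
  e \notin s.
Proof.
move=> /wfP[+ _] vV ev; rewrite /ends cat_uniq => /and3P[_ /hasPn/(_ e) + _].
by apply; apply/flatten_mapP; exists v.
Qed.

Lemma subrACA (M : zmodType) (a b c d : M) : a - b - (c - d) = a - c - (b - d).
Proof. by rewrite !opprB [d - c]addrC [d - b]addrC addrACA. Qed.

Lemma perm_eq2 (T : eqType) (p q u v : T) : perm_eq [:: p; q] [:: u; v] ->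
  (p = u /\ q = v) \/ (p = v /\ q = u).
Proof.
move=> H; have : p \in [:: u; v] by rewrite -(perm_mem H) inE eqxx.
have C : perm_eq [:: u; v] [:: v; u] by rewrite (perm_catC [:: u] [:: v]).
rewrite !inE => /orP[] /eqP E; move: H; rewrite E.
  by rewrite perm_cons => /perm_small_eq => /(_ isT)[->]; left.
rewrite (permPr C) perm_cons => /perm_small_eq => /(_ isT)[->].
by right.
Qed.

Lemma perm_swap (T : eqType) (v w : T) U : perm_eq [:: v, w & U] [:: w, v & U].
Proof. by rewrite -(perm_catCA [:: w] [:: v]). Qed.

Lemma perm_to_rem2 (T : eqType) (v w : T) V : v \in V -> w \in V -> v != w ->
  exists U, perm_eq V [:: v, w & U].
Proof.
move=> vV wV vw; exists (rem w (rem v V)).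
apply: perm_trans (perm_to_rem vV) _; rewrite perm_cons perm_to_rem //.
by move: wV; rewrite (perm_mem (perm_to_rem vV)) inE eq_sym (negbTE vw).
Qed.

Lemma vends_disjoint s v V w e : jacobi_wf (s, v :: V) -> w \in V ->
  e \in vends v -> e \notin vends w.
Proof.
move=> /wfP[+ _] wV ev; rewrite /ends flatten_vends !cat_uniq.
move=> /and3P[_ _ /and3P[_ /hasPn H _]]; apply/negP => ew.
have /H /= : e \in flatten (map vends V) by apply/flatten_mapP; exists w.
by rewrite ev.
Qed.

(** * Removing a vertex through a leg, and counting legs *)

(** Only the edge through [x] disappears; the other two half-edges at [v] move to the skeleton. *)
Lemma ends_resolve s V v x y z : jacobi_wf (s, v :: V) -> x \in s ->
  leg v x y z ->
  perm_eq (ends s (v :: V)) [:: x, partner x & ends (sub x [:: y; z] s) V].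
Proof.
move=> W xs L; have pv := leg_perm L.
have /wfP[U _] := W.
have c1 : count_mem x s = 1%N.
  by rewrite count_uniq_mem ?xs //; move: U; rewrite cat_uniq => /andP[].
apply/permP => p; rewrite /ends flatten_vends /= !count_cat.
have := count_sub p x [:: y; z] s; rewrite c1 !mul1n /=.
have /permP/(_ p) /= := pv; lia.
Qed.

Lemma wf_resolve s V v x y z : jacobi_wf (s, v :: V) -> x \in s ->
  leg v x y z ->
  jacobi_wf (sub x [:: y; z] s, V) /\ jacobi_wf (sub x [:: z; y] s, V).
Proof.
move=> W xs L; have p := ends_resolve W xs L.
have W1 : jacobi_wf (sub x [:: y; z] s, V).
  have /wfP[U C] := W; apply/wfP; move: U; rewrite (perm_uniq p) /=.
  rewrite !inE !negb_or => /and3P[/andP[_ x1] x2 U]; split=> // e.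
  have := C e; rewrite !(perm_mem p) !inE (can2_eq partnerK partnerK).
  rewrite (inj_eq (can_inj partnerK)).
  case: (eqVneq e x) => [-> _ | _]; first by rewrite (negbTE x1) (negbTE x2).
  case: (eqVneq e (partner x)) => [-> _ | _ //].
  by rewrite partnerK (negbTE x1) (negbTE x2).
split=> //; suff p' : perm_eq (sub x [:: z; y] s) (sub x [:: y; z] s).
  by rewrite (wf_perm p' (perm_refl V)).
by apply: perm_sub; rewrite (perm_catC [:: z] [:: y]).
Qed.

Definition legs (s : seq endpoint) : seq endpoint :=
  [seq e <- s | partner e \notin s].

Lemma mem_legs e s : (e \in legs s) = (e \in s) && (partner e \notin s).
Proof. by rewrite mem_filter andbC. Qed.

Lemma legs_vertex s V x : jacobi_wf (s, V) -> x \in legs s ->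
  exists v y z, v \in V /\ leg v x y z.
Proof.
rewrite mem_legs => /wfP[_ C] /andP[xs px].
have : partner x \in ends s V by rewrite C mem_cat xs.
rewrite mem_cat (negbTE px) => /flatten_mapP[v vV /legP[y [z L]]].
by exists v, y, z; rewrite partnerK in L.
Qed.

Lemma leg_vends v x y z : leg v x y z ->
  [/\ partner x \in vends v, y \in vends v & z \in vends v].
Proof. by move/leg_perm/perm_mem => H; rewrite -!H !inE !eqxx ?orbT. Qed.

Lemma leg_legs s V v x y z : jacobi_wf (s, V) -> v \in V -> x \in s ->
  leg v x y z -> x \in legs s.
Proof.
move=> W vV xs /leg_vends[xv _ _]; rewrite mem_legs xs.
exact: ends_disjoint W vV xv.
Qed.

Definition is_tail (e : endpoint) : bool := if e is Tl _ then true else false.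

Lemma partner_is_tail e : is_tail (partner e) = ~~ is_tail e.
Proof. by case: e. Qed.

(* Every internal vertex has one more incoming than outgoing edges. *)
Lemma count_legs s V : jacobi_wf (s, V) ->
  (count is_tail (legs s) = count (predC is_tail) (legs s) + size V)%N.
Proof.
move=> /wfP[U C].
(* Used for all half-edges and for those of the arrows with both ends on the skeleton; the
   difference leaves the legs and the half-edges at the vertices. *)
have half (t : seq endpoint) : uniq t ->
    (forall e, (partner e \in t) = (e \in t)) ->
    count is_tail t = count (predC is_tail) t.
  move=> Ut Ct; rewrite -!size_filter -(size_map partner); apply: perm_size.
  apply: uniq_perm; rewrite ?filter_uniq //.
    by rewrite map_inj_uniq ?filter_uniq //; exact: can_inj partnerK.
  move=> e; rewrite -[e in LHS]partnerK (mem_map (can_inj partnerK)).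
  by rewrite !mem_filter /= partner_is_tail Ct.
have Us : uniq s by move: U; rewrite cat_uniq => /andP[].
have H1 := half _ U C.
have H2 : count is_tail [seq e <- s | partner e \in s] =
          count (predC is_tail) [seq e <- s | partner e \in s].
  by apply: half; [exact: filter_uniq | move=> e;
    rewrite !mem_filter partnerK andbC].
have sp (p : pred endpoint) :
    count p s = (count p [seq e <- s | partner e \in s] + count p (legs s))%N.
  have sq (q : pred endpoint) t :
      count p t = (count p (filter q t) + count p (filter (predC q) t))%N.
    by elim: t => //= e t ->; case: (q e) => /=; lia.
  exact: sq.
have cV : (count is_tail (flatten (map vends V)) = size V /\
           count (predC is_tail) (flatten (map vends V)) = (size V).*2)%N.
  by elim: (V) => //= v V' [IH1 IH2]; rewrite IH1 IH2; lia.
by move: H1; rewrite !count_cat !sp H2 !cV.1 !cV.2; lia.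
Qed.

Lemma sub_splitP x s : uniq s -> x \in s ->
  exists s1 s2, [/\ s = s1 ++ x :: s2, x \notin s1, x \notin s2 &
                 forall w, sub x w s = s1 ++ w ++ s2].
Proof.
move=> U xs; case/splitPr: xs U => s1 s2; rewrite cat_uniq /= negb_or => U.
have [x1 x2] : x \notin s1 /\ x \notin s2 by case/and4P: U => _ /andP[].
by exists s1, s2; split=> // w; rewrite sub_split.
Qed.

Lemma wf_uniq s V : jacobi_wf (s, V) -> uniq s.
Proof. by case/wfP; rewrite cat_uniq => /andP[]. Qed.

(* The junk value is 0 on words that do not encode an arrow diagram. *)
Definition word_class (s : seq endpoint) : Aw :=
  if insub s is Some D then class_w (arrow_gen D) else 0.

Lemma word_classE (D : arrow_word) : word_class (skeleton D) =
  class_w (arrow_gen D).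
Proof. by rewrite /word_class valK. Qed.

Lemma word_of s : jacobi_wf (s, [::]) -> exists D : arrow_word, skeleton D = s.
Proof. by rewrite wf_arrow => W; exists (ArrowWord W). Qed.

Lemma wf_rename f s : injective f ->
  jacobi_wf (map (rename_endpoint f) s, [::]) = jacobi_wf (s, [::]).
Proof.
move=> fI; rewrite !wf_arrow tails_rename heads_rename map_inj_uniq //.
by congr andb; apply/idP/idP => [/(perm_map_inj fI) | /(perm_map f)].
Qed.

Lemma word_class_rename f s : bijective f -> word_class (map (rename_endpoint f)
  s) = word_class s.
Proof.
move=> bf; have fI := bij_inj bf; case: (boolP (jacobi_wf (s, [::]))) => W.
  have [D DE] := word_of W.
  have W' := W; rewrite -(wf_rename _ fI) in W'.
  have [E EE] := word_of W'; rewrite -EE -DE.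
  rewrite !word_classE /arrow_gen; congr (class_w << _ >>); apply/eqmodP.
  have [g bg fK] := bij_nat_inv bf; apply/asboolP; exists g => //.
  by rewrite EE -DE (mapK (rename_endpointK fK)).
by rewrite /word_class !insubN -?wf_arrow ?wf_rename.
Qed.

(** * Consequences of TC and 4T for words in [Aw] *)

Lemma word_class_TC s1 s2 a b : jacobi_wf (s1 ++ [:: Tl a; Tl b] ++ s2, [::]) ->
  word_class (s1 ++ [:: Tl a; Tl b] ++ s2) =
    word_class (s1 ++ [:: Tl b; Tl a] ++ s2).
Proof.
move=> W; have p : perm_eq (s1 ++ [:: Tl b; Tl a] ++ s2)
  (s1 ++ [:: Tl a; Tl b] ++ s2).
  by rewrite perm_cat2l perm_cat2r (perm_catC [:: Tl b] [:: Tl a]).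
have := W; rewrite -(wf_perm p (perm_refl _)) => W'.
have [[D DE] [E EE]] := (word_of W, word_of W').
rewrite -DE -EE !word_classE; apply/lquot_projP/mem_span_of.
exact: w_TC DE EE.
Qed.

Lemma word_class_4T s1 s2 s3 a b x y : perm_eq [:: x; y] [:: Tl a; Hd a] ->
  jacobi_wf (Hd b :: s1 ++ [:: x] ++ s2 ++ [:: y] ++ s3, [::]) ->
  word_class (s1 ++ [:: Hd b; x] ++ s2 ++ [:: y] ++ s3) -
  word_class (s1 ++ [:: x; Hd b] ++ s2 ++ [:: y] ++ s3) =
  - (word_class (s1 ++ [:: x] ++ s2 ++ [:: Hd b; y] ++ s3) -
     word_class (s1 ++ [:: x] ++ s2 ++ [:: y; Hd b] ++ s3)).
Proof.
move=> pxy W.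
have wd u : perm_eq (Hd b :: s1 ++ [:: x] ++ s2 ++ [:: y] ++ s3) u ->
    exists D : arrow_word, skeleton D = u.
  by move=> p; apply: word_of; rewrite -(wf_perm p (perm_refl _)).
have [] := wd (s1 ++ [:: Hd b; x] ++ s2 ++ [:: y] ++ s3); last move=> D1 E1.
  by apply/permP => p; rewrite /= !count_cat /= !count_cat /=; lia.
have [] := wd (s1 ++ [:: x; Hd b] ++ s2 ++ [:: y] ++ s3); last move=> D3 E3.
  by apply/permP => p; rewrite /= !count_cat /= !count_cat /=; lia.
have [] := wd (s1 ++ [:: x] ++ s2 ++ [:: Hd b; y] ++ s3); last move=> D2 E2.
  by apply/permP => p; rewrite /= !count_cat /= !count_cat /=; lia.
have [] := wd (s1 ++ [:: x] ++ s2 ++ [:: y; Hd b] ++ s3); last move=> D4 E4.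
  by apply/permP => p; rewrite /= !count_cat /= !count_cat /=; lia.
rewrite -E1 -E2 -E3 -E4 !word_classE; apply/eqP;
  rewrite -subr_eq0 opprK addrACA -opprD.
rewrite -!raddfD -raddfB; apply/eqP; rewrite -[RHS](raddf0 class_w).
apply/lquot_projP/mem_span_of; rewrite subr0.
exact: w_4T pxy E1 E2 E3 E4.
Qed.

(** The order of the two ends of [a] on the skeleton drops out, since exchanging their roles only
    negates both sides of 4T. *)
Lemma word_class_4T_sub t a b : jacobi_wf (Hd b :: t, [::]) -> Tl a \in t ->
  Hd a \in t ->
  word_class (sub (Tl a) [:: Hd b; Tl a] t) -
  word_class (sub (Tl a) [:: Tl a; Hd b] t) =
  - (word_class (sub (Hd a) [:: Hd b; Hd a] t) -
  word_class (sub (Hd a) [:: Hd a; Hd b] t)).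
Proof.
move=> W ta ha; have U : uniq t by case/andP: (wf_uniq W).
have [s1 [s2 [E x1 x2 H]]] := sub_splitP U ta; rewrite !H.
have : Hd a \in s1 ++ s2 by move: ha; rewrite E !mem_cat inE.
have [U1 U2] : uniq s1 /\ uniq s2.
  by move: U; rewrite E cat_uniq /= => /and4P[].
have [y1 y2] : (Hd a \in s1 -> Hd a \notin s2) /\ (Hd a \in s2 ->
  Hd a \notin s1).
  move: U; rewrite E cat_uniq => /and3P[_ /hasPn D _].
  split=> h; last by apply: D; rewrite inE h orbT.
  by apply/negP => h2; move: (D (Hd a)); rewrite inE h2 orbT h => /(_ isT).
rewrite E in W; rewrite mem_cat => /orP[h | h].
  have [u1 [u2 [E1 _ _ H1]]] := sub_splitP U1 h; rewrite E.
  rewrite !sub_cat !H1 !sub_cons /= !(sub_id _ (y1 h)).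
  rewrite E1 -!catA in W *; symmetry; rewrite -[RHS]opprK; congr (- _).
  by apply: (word_class_4T (a := a) _ W);
    rewrite (perm_catC [:: Hd a] [:: Tl a]).
have [u1 [u2 [E1 _ _ H1]]] := sub_splitP U2 h; rewrite E.
rewrite !sub_cat !sub_cons /= !(sub_id _ (y2 h)) !H1.
by rewrite E1 in W *; apply: (word_class_4T (a := a) _ W).
Qed.

(** With nothing between the two ends of the arrow, the two middle terms of 4T are the same word and
    cancel. *)
Lemma word_class_isolated s1 s2 a b y z : perm_eq [:: y; z] [:: Tl a; Hd a] ->
  jacobi_wf (s1 ++ [:: Hd b; y; z] ++ s2, [::]) ->
  word_class (s1 ++ [:: Hd b; y; z] ++ s2) =
    word_class (s1 ++ [:: y; z; Hd b] ++ s2).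
Proof.
move=> p W; have /(word_class_4T p)
  : jacobi_wf (Hd b :: s1 ++ [:: y] ++ [::] ++ [:: z] ++ s2, [::]).
  rewrite -(wf_perm _ (perm_refl [::])
    : jacobi_wf (s1 ++ [:: Hd b; y; z] ++ s2, [::]) = _) //.
  by apply/permP => q; rewrite /= !count_cat /=; lia.
move=> /= /eqP; rewrite opprB subr_eq addrNK => /eqP; exact.
Qed.

(** * Transpositions of edge names and the Y *)

Definition swap (a b c : nat) : nat :=
  if c == a then b else if c == b then a else c.

Lemma swapK a b : involutive (swap a b).
Proof.
move=> c; rewrite /swap; case: (eqVneq c a) => [-> | ca].
  by rewrite eqxx; case: (eqVneq b a) => [-> | _].
case: (eqVneq c b) => [-> | cb]; first by rewrite eqxx.
by rewrite (negbTE ca) (negbTE cb).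
Qed.

Lemma swap_bij a b : bijective (swap a b).
Proof. by exists (swap a b); exact: swapK. Qed.

Lemma swapl a b : swap a b a = b. Proof. by rewrite /swap eqxx. Qed.

Lemma swapr a b : swap a b b = a.
Proof. by rewrite /swap eqxx; case: eqP. Qed.

Lemma swap_neq a b c : c != a -> c != b -> swap a b c = c.
Proof. by rewrite /swap => /negbTE-> /negbTE->. Qed.

(** Of the four half-edges of [a] and [o] only [Tl a] and [Hd o] can occur in [s], so the
    transposition amounts to two substitutions, the form that a removal produces. *)
Lemma map_rename_swap s a o : Hd a \notin s -> Tl o \notin s ->
  map (rename_endpoint (swap a o)) s =
  sub (Hd o) [:: Hd a] (sub (Tl a) [:: Tl o] s).
Proof.
move=> ha to; rewrite [sub (Tl a) _ _]/sub sub_flatten -[LHS]flatten_seq1.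
rewrite -map_comp; congr flatten; apply/eq_in_map => e es.
case: (eqVneq e (Tl a)) => [-> | ea]; first by rewrite /= swapl.
rewrite sub1E; case: (eqVneq e (Hd o)) => [-> | eo]; first by rewrite /= swapr.
rewrite /=; congr [:: _]; case: e es ea eo => c es /=.
  rewrite end_eqE => ca _; rewrite swap_neq //.
  by apply: contraNneq to => <-.
rewrite end_eqE => _ co; rewrite swap_neq //.
by apply: contraNneq ha => <-.
Qed.

(* The three ways to remove the vertex of a Y-shaped component agree: this is
   4T for the arrow o, once the surviving edges are renamed. *)
Lemma word_class_Y s a b o : jacobi_wf (sub (Tl a) [:: Hd b; Tl o] s, [::]) ->
  Tl a \in s -> Hd o \in s -> Hd a \notin s -> Tl o \notin s -> uniq s ->
  b != a ->
  word_class (sub (Tl a) [:: Hd b; Tl o] s) -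
  word_class (sub (Tl a) [:: Tl o; Hd b] s) =
  word_class (sub (Hd o) [:: Hd a; Hd b] s) -
  word_class (sub (Hd o) [:: Hd b; Hd a] s).
Proof.
(* In [t] the tail of [a] is relabelled as the tail of [o]; together with [Hd o] it forms the arrow
   across which [Hd b] is moved. *)
move=> W tas hos has tos U ba; set t := sub (Tl a) [:: Tl o] s.
have c1 : count_mem (Tl a) s = 1%N by rewrite count_uniq_mem ?tas.
have Wt : jacobi_wf (Hd b :: t, [::]).
  rewrite -(wf_perm _ (perm_refl [::])
    : jacobi_wf (sub (Tl a) [:: Hd b; Tl o] s, [::]) = _) //.
  apply/permP => q /=; have := count_sub q (Tl a) [:: Hd b; Tl o] s.
  by have := count_sub q (Tl a) [:: Tl o] s; rewrite c1 /= -/t; lia.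
have hat : Hd a \notin t by apply: sub_notin.
have bo : b != o.
  have : Hd b \notin t by case/andP: (wf_uniq Wt).
  by apply: contraNneq => ->; rewrite mem_sub // hos orbT.
have T w : sub (Tl a) w s = sub (Tl o) w t.
  by rewrite /t sub_sub // sub1E eqxx.
(* Removal at the head of [o] keeps the name [a]; exchanging [a] and [o] turns the result into a
   word over [t]. *)
have H c d : word_class (sub (Hd o) [:: Hd c; Hd d] s) =
             word_class (sub (Hd o) [:: Hd (swap a o c); Hd (swap a o d)] t).
  rewrite -(word_class_rename _ (swap_bij a o)) map_rename_sub; last first.
    exact: bij_inj (swap_bij a o).
  by rewrite /= swapr map_rename_swap // sub_sub // sub1E eqxx.
rewrite !T !H swapl (swap_neq ba bo) word_class_4T_sub //;
  first by rewrite opprB.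
  by rewrite mem_sub // inE eqxx.
by rewrite mem_sub // hos orbT.
Qed.

(** * The map [phi], which removes all vertices *)

Definition bracket (M : zmodType) (F : seq endpoint -> M) x y z s : M :=
  F (sub x [:: y; z] s) - F (sub x [:: z; y] s).

(** A predicate on values, so that the choice made in [phi_rec] depends on nothing but the set of
    possible values. Invariance under renaming and under permuting the vertices then follows from
    equality of these sets, before independence of the choices is known. *)
Definition step (F : seq endpoint -> seq ivertex -> Aw) s V (u : Aw) : Prop :=
  exists v V' x y z, [/\ perm_eq V (v :: V'), leg v x y z, x \in s &
                         u = bracket (F^~ V') x y z s].

(* Removes all internal vertices through arbitrarily chosen legs; the junk value
   is 0 when there is no leg. *)
Fixpoint phi_rec n s V : Aw :=
  if n is n'.+1 then
    if pselect (exists u, step (phi_rec n') s V u) is left h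
    then projT1 (cid h) else 0
  else word_class s.

Definition phi s V : Aw := phi_rec (size V) s V.

Lemma phi_nil s : phi s [::] = word_class s. Proof. by []. Qed.

Lemma phi_rec_perm n s V W : perm_eq V W -> phi_rec n s V = phi_rec n s W.
Proof.
case: n => //= n pVW; suff -> : step (phi_rec n) s V =
  step (phi_rec n) s W by [].
apply: funext => u; apply: propext.
by split=> -[v [V' [x [y [z [p L xs ->]]]]]]; exists v, V', x, y, z; split=> //;
  rewrite -(permPl pVW) || rewrite (permPl pVW).
Qed.

Lemma phi_perm s V W : perm_eq V W -> phi s V = phi s W.
Proof. by move=> p; rewrite /phi (perm_size p) (phi_rec_perm _ _ p). Qed.

Lemma bracket_perm x y z s V W : perm_eq V W ->
  bracket (phi^~ V) x y z s = bracket (phi^~ W) x y z s.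
Proof. by move=> p; rewrite /bracket !(phi_perm _ p). Qed.

Lemma phi_rec_rename n f s V : bijective f ->
  phi_rec n (map (rename_endpoint f) s) (map (rename_ivertex f) V) =
  phi_rec n s V.
Proof.
elim: n f s V => [|n IH] f s V bf; first exact: word_class_rename.
have dir f' s' V' u : bijective f' -> step (phi_rec n) s' V' u ->
    step (phi_rec n) (map (rename_endpoint f') s') (map (rename_ivertex f') V')
      u.
  move=> bf' [v [W [x [y [z [p L xs ->]]]]]].
  exists (rename_ivertex f' v), (map (rename_ivertex f') W).
  exists (rename_endpoint f' x), (rename_endpoint f' y), (rename_endpoint f' z).
  split; [exact: (perm_map (rename_ivertex f') p) | exact: leg_rename
         | exact: map_f |].
  rewrite /bracket /=.
  by congr (_ - _); rewrite -[LHS](IH f') // map_rename_sub //; exact: bij_inj.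
rewrite /=.
suff -> : step (phi_rec n) (map (rename_endpoint f) s) (map (rename_ivertex f)
  V) =
          step (phi_rec n) s V by [].
apply: funext => u; apply: propext; split; last exact: dir.
have [g bg fK] := bij_nat_inv bf; move/(dir g _ _ _ bg).
by rewrite (mapK (rename_endpointK fK)) (mapK (rename_ivertexK fK)).
Qed.

Lemma phi_rename f s V : bijective f ->
  phi (map (rename_endpoint f) s) (map (rename_ivertex f) V) = phi s V.
Proof. by move=> bf; rewrite /phi size_map phi_rec_rename. Qed.

(** * Independence of the order of removal *)

(** The induction hypothesis: [phi] may be computed through any leg when there are at most [n]
    vertices, [v] included. *)
Definition resolvable n := forall s v V x y z, (size V < n)%N ->
  jacobi_wf (s, v :: V) -> x \in s -> leg v x y z ->
  phi s (v :: V) = bracket (phi^~ V) x y z s.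

(** Each side is expanded at the leg of the other vertex; both become the same alternating sum of
    four values, up to the order of the two middle terms. *)
Lemma resolve_commute n s v w U x y z x' y' z' : resolvable n ->
  (size U < n)%N ->
  jacobi_wf (s, [:: v, w & U]) -> x \in s -> x' \in s ->
  leg v x y z -> leg w x' y' z' ->
  bracket (phi^~ (w :: U)) x y z s = bracket (phi^~ (v :: U)) x' y' z' s.
Proof.
move=> R Un W xs xs' L L'.
have pvw := perm_swap v w U.
have W' := W; rewrite (wf_perm (perm_refl s) pvw) in W'.
have [px yv zv] := leg_vends L; have [px' yw zw] := leg_vends L'.
have vV : v \in [:: v, w & U] by rewrite inE eqxx.
have wV : w \in [:: v, w & U] by rewrite !inE eqxx orbT.
have nin e e' : e \in s -> e' \in vends v ++ vends w -> e != e'.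
  rewrite mem_cat => es /orP[] /(ends_disjoint W); last 1 first.
    by move/(_ wV); apply: contraNneq => <-.
  by move/(_ vV); apply: contraNneq => <-.
(* Equality would place the half-edge [partner x] at both [v] and [w]. *)
have xx' : x != x'.
  have := ends_resolve W xs L; have /wfP[U1 _] := W.
  move=> /perm_uniq; rewrite U1 => /esym /and3P[_ H _].
  apply: contraNneq H => ->; rewrite mem_cat flatten_vends mem_cat px'.
  by rewrite orbT.
have [W1 W2] := wf_resolve W xs L; have [W1' W2'] := wf_resolve W' xs' L'.
have N e u v' : e \in s -> u \in vends v -> v' \in vends v ->
  e \notin [:: u; v'].
  by move=> es uv vv; rewrite !inE negb_or !nin // mem_cat ?uv ?vv.
have N' e u v' : e \in s -> u \in vends w -> v' \in vends w ->
  e \notin [:: u; v'].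
  by move=> es uv vv; rewrite !inE negb_or !nin // mem_cat ?uv ?vv orbT.
have M e f u1 u2 : e \in s -> f \in s -> e != f -> e \in sub f [:: u1; u2] s.
  by move=> es fs ef; rewrite mem_sub // ef es orbT.
rewrite /bracket.
rewrite (R _ _ _ _ _ _ Un W1 (M _ _ _ _ xs' xs _) L') 1?eq_sym //.
rewrite (R _ _ _ _ _ _ Un W2 (M _ _ _ _ xs' xs _) L') 1?eq_sym //.
rewrite (R _ _ _ _ _ _ Un W1' (M _ _ _ _ xs xs' xx') L).
rewrite (R _ _ _ _ _ _ Un W2' (M _ _ _ _ xs xs' xx') L).
rewrite /bracket.
rewrite (subC _ xx' (N' _ _ _ xs yw zw) (N _ _ _ xs' yv zv)).
rewrite (subC _ xx' (N' _ _ _ xs yw zw) (N _ _ _ xs' zv yv)).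
rewrite (subC _ xx' (N' _ _ _ xs zw yw) (N _ _ _ xs' yv zv)).
rewrite (subC _ xx' (N' _ _ _ xs zw yw) (N _ _ _ xs' zv yv)).
by rewrite subrACA.
Qed.

(** Once [v] is removed, [Tl o] is a leg of [w], and removing [w] opens the bubble into an arrow [c]
    with adjacent ends. The head of [b] slides across it, so the two terms of the bracket agree. *)
Lemma bubble_zero s v w a b o c y z : resolvable 1 ->
  jacobi_wf (s, [:: v; w]) -> Tl a \in s -> leg v (Tl a) y z ->
  perm_eq [:: y; z] [:: Hd b; Tl o] -> out_ w = c ->
  perm_eq [:: inl_ w; inr_ w] [:: o; c] ->
  bracket (phi^~ [:: w]) (Tl a) y z s = 0.
Proof.
move=> R W as_ L pyz oc poc.
have {poc} [y' [z' [L' pyz']]] : exists y' z', leg w (Tl o) y' z' /\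
    perm_eq [:: y'; z'] [:: Tl c; Hd c].
  case: w oc poc {W} => p q _ /= -> poc.
  case/perm_eq2: poc => -[-> ->].
    by exists (Hd c), (Tl c); split; [constructor | exact: perm_swap].
  by exists (Tl c), (Hd c); split; [constructor |].
have wV : w \in [:: v; w] by rewrite !inE eqxx orbT.
have tos : Tl o \notin s.
  apply: (ends_disjoint W (v := v)); first by rewrite inE eqxx.
  rewrite -(perm_mem (leg_perm L)) inE; apply/orP; right.
  by rewrite (perm_mem pyz) !inE eqxx orbT.
have ao : Tl a != Tl o by apply: contraTneq as_ => ->.
have F u : jacobi_wf (sub (Tl a) u s, [:: w]) -> Tl o \in u ->
    phi (sub (Tl a) u s) [:: w] =
    word_class (sub (Tl a) (sub (Tl o) [:: y'; z'] u) s) -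
    word_class (sub (Tl a) (sub (Tl o) [:: z'; y'] u) s).
  move=> Wu ou; rewrite (R _ _ _ _ _ _ _ Wu _ L') //; last first.
    by rewrite mem_sub // ou.
  by rewrite /bracket !sub_sub.
have K y1 z1 : perm_eq [:: y1; z1] [:: Tl c; Hd c] ->
    jacobi_wf (sub (Tl a) [:: Hd b; y1; z1] s, [::]) ->
    word_class (sub (Tl a) [:: Hd b; y1; z1] s) =
      word_class (sub (Tl a) [:: y1; z1; Hd b] s).
  move=> p1 W1; have [s1 [s2 [_ _ _ H]]] := sub_splitP (wf_uniq W) as_.
  by rewrite !H; apply: (word_class_isolated p1); rewrite -H.
have [W1 W2] := wf_resolve W as_ L.
have main : phi (sub (Tl a) [:: Hd b; Tl o] s) [:: w] =
            phi (sub (Tl a) [:: Tl o; Hd b] s) [:: w].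
  have Wa : jacobi_wf (sub (Tl a) [:: Hd b; Tl o] s, [:: w]).
    by rewrite -(wf_perm (perm_sub (Tl a) s pyz) (perm_refl [:: w])).
  have Wb : jacobi_wf (sub (Tl a) [:: Tl o; Hd b] s, [:: w]).
    have p : perm_eq [:: Tl o; Hd b] [:: Hd b; Tl o].
      by rewrite (perm_catC [:: Tl o] [:: Hd b]).
    by rewrite (wf_perm (perm_sub (Tl a) s p) (perm_refl [:: w])).
  have To u : Tl o \in u -> Tl o \in sub (Tl a) u s by move=> H;
    rewrite mem_sub // H.
  have bo : Hd b == Tl o = false by [].
  rewrite !F ?inE ?eqxx ?orbT //.
  have oin : Tl o \in [:: Hd b; Tl o] by rewrite !inE eqxx orbT.
  have [Wc Wd] := wf_resolve Wa (To _ oin) L'.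
  rewrite sub_sub // in Wc; rewrite sub_sub // in Wd.
  move: Wc Wd; rewrite !sub_cons !eqxx !bo /= => Wc Wd.
  rewrite (K y' z') // (K z' y') //.
  by rewrite (perm_catC [:: z'] [:: y']).
by rewrite /bracket; case/perm_eq2: pyz => -[-> ->]; rewrite main subrr.
Qed.

Lemma legs_uniq s V : jacobi_wf (s, V) -> uniq (legs s).
Proof. by move/wf_uniq => U; exact: filter_uniq. Qed.

(** Edges ending at [w] cannot start on the skeleton, as all legs end at the other vertex. The only
    tails left for them are those of [o] and of the output of [w]. *)
Lemma two_legs_bubble s w l r o : jacobi_wf (s, [:: IVertex l r o; w]) ->
  {subset legs s <= [:: Tl l; Tl r]} ->
  perm_eq [:: inl_ w; inr_ w] [:: o; out_ w].
Proof.
move=> W sl; case: w W => p q c W /=.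
set v := IVertex l r o in W *.
have vV : v \in [:: v; IVertex p q c] by rewrite inE eqxx.
have wV : IVertex p q c \in [:: v; IVertex p q c] by rewrite !inE eqxx orbT.
have /wfP[_ C] := W.
have K e : e \in [:: p; q] -> e \in [:: o; c].
  move=> epq; have ev : Hd e \in vends (IVertex p q c).
    by move: epq; rewrite !inE !end_eqE orFb.
  have : Tl e \in ends s [:: v; IVertex p q c].
    by rewrite -(C (Tl e)) /= (mem_ends_vends _ wV ev).
  rewrite mem_cat => /orP[es | ]; last by rewrite /= !inE !end_eqE /= !orbF.
  have : Tl e \in legs s by rewrite mem_legs es (ends_disjoint W wV ev).
  move/sl => elr; have ev' : Hd e \in vends v.
    by move: elr; rewrite !inE !end_eqE orFb.
  have w1 : IVertex p q c \in [:: IVertex p q c] by rewrite inE.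
  by rewrite (negPf (vends_disjoint W w1 ev')) in ev.
have Uw := uniq_vends W wV; rewrite /= !inE !end_eqE /= andbT in Uw.
have U1 : uniq [:: p; q] by rewrite /= inE andbT.
have sz : (size [:: o; c] <= size [:: p; q])%N by [].
exact: uniq_perm U1 (leq_size_uniq U1 K sz) (uniq_min_size U1 K sz).2.
Qed.

Lemma leg_far l r o x y z : leg (IVertex l r o) x y z ->
  x \in [:: Hd o; Tl l; Tl r].
Proof. by move=> L; inversion L; rewrite !inE eqxx ?orbT. Qed.

Lemma resolve_agree_at n s v V x y z x' y' z' : resolvable n -> size V = n ->
  jacobi_wf (s, v :: V) -> x \in s -> x' \in s -> leg v x y z ->
    leg v x' y' z' ->
  bracket (phi^~ V) x y z s = bracket (phi^~ V) x' y' z' s.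
Proof.
move=> R sV W xs xs' L L'.
have vV : v \in v :: V by rewrite inE eqxx.
have [[x1 [u [y1 [z1 [x1s uV L1]]]]] | none] := pselect (exists x1 u y1 z1,
    [/\ x1 \in s, u \in V & leg u x1 y1 z1]).
  have pV := perm_to_rem uV; set U := rem u V in pV.
  have Wv : jacobi_wf (s, [:: v, u & U]).
    have p : perm_eq (v :: V) [:: v, u & U] by rewrite perm_cons.
    by rewrite -(wf_perm (perm_refl s) p).
  have Un : (size U < n)%N by rewrite -sV (perm_size pV).
  rewrite !(bracket_perm _ _ _ _ pV).
  by rewrite !(resolve_commute R Un Wv _ x1s _ L1).
have sl e : e \in legs s -> exists y1 z1, leg v e y1 z1.
  move=> /[dup] /(legs_vertex W) [u [y1 [z1 [+ L1]]]].
  rewrite mem_legs inE => /orP[/eqP<- | uV] /andP[es _]; first by exists y1, z1.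
  by case: none; exists e, u, y1, z1.
case: (eqVneq x x') => [E | xx'].
  by rewrite -E in L' *; have [-> ->] := leg_fun (uniq_vends W vV) L L'.
have {}sl : {subset legs s <=
  (let: IVertex l r o := v in [:: Hd o; Tl l; Tl r])}.
  by case: (v) sl => l r o sl e /sl[y1 [z1 /leg_far]].
have xl := leg_legs W vV xs L; have xl' := leg_legs W vV xs' L'.
have cnt := count_legs W; have Ul := legs_uniq W; have Uv := uniq_vends W vV.
case: v => l r o in W L L' vV sl cnt Uv *.
have Uf : uniq [:: Hd o; Tl l; Tl r].
  by rewrite -(map_inj_uniq (can_inj partnerK)).
have pl : perm_eq (legs s) [seq e <- [:: Hd o; Tl l; Tl r] | e \in legs s].
  apply: uniq_perm => //; first exact: filter_uniq.
  by move=> e; rewrite mem_filter andb_idr // => /sl.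
(* All legs are now at [v], so the count compares the tails of l and r with the head of o and the
   number of vertices. If [Hd o] is a leg, both tails are legs and [v] is the only vertex. If not,
   there are as many tail legs as vertices, so two distinct legs leave exactly one other vertex. *)
move: cnt; rewrite !(permP pl) /=.
have fl e : e \in legs s -> e \in s by rewrite mem_legs => /andP[].
have [ho | ho] := boolP (Hd o \in legs s).
  have [hl | hl] := boolP (Tl l \in legs s); last by case: (_ \in legs s).
  have [hr | hr] := boolP (Tl r \in legs s); last by case.
  move=> [/esym/size0nil V0]; rewrite V0 in W *.
  have lr : l != r by move: Uf; rewrite /= !inE !end_eqE /= andbT.
  have rl : r != l by rewrite eq_sym.
  have nin e : e \in vends (IVertex l r o) -> e \notin s.
    by apply: (ends_disjoint W); rewrite inE eqxx.
  have [no nl nr] : [/\ Tl o \notin s, Hd l \notin s & Hd r \notin s].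
    by split; apply: nin; rewrite !inE eqxx ?orbT.
  have LL := leg_left l r o; have LR := leg_right l r o.
  have [Wl _] := wf_resolve W (fl _ hl) LL; have [_ Wr] := wf_resolve W (fl _
    hr) LR.
  have Us := wf_uniq W.
  have Yl : bracket (phi^~ [::]) (Tl l) (Hd r) (Tl o) s =
            bracket (phi^~ [::]) (Hd o) (Hd l) (Hd r) s.
    by apply: word_class_Y; rewrite ?nl ?nr ?no ?(fl _ ho) ?(fl _ hl) ?(fl _
      hr).
  (* The mirror image of [Yl]: exchanging l and r reverses both commutators. *)
  have Yr : bracket (phi^~ [::]) (Tl r) (Tl o) (Hd l) s =
            bracket (phi^~ [::]) (Hd o) (Hd l) (Hd r) s.
    rewrite /bracket -[LHS]opprB -[RHS]opprB; congr (- _).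
    by apply: word_class_Y; rewrite ?nl ?nr ?no ?(fl _ ho) ?(fl _ hl) ?(fl _
      hr).
  by inversion L; inversion L'; subst => //; rewrite ?Yl ?Yr.
have {}sl : {subset legs s <= [:: Tl l; Tl r]}.
  move=> e el; have := sl e el; rewrite inE => /orP[/eqP E|] //.
  by rewrite -E el in ho.
have [hl | hl] := boolP (Tl l \in legs s); last first.
  have E e : e \in legs s -> e = Tl r.
    by move=> el; move: (sl e el); rewrite !inE => /orP[] /eqP E //;
      rewrite -E el in hl.
  by rewrite (E x) // (E x') // eqxx in xx'.
have [hr | hr] := boolP (Tl r \in legs s); last first.
  have E e : e \in legs s -> e = Tl l.
    by move=> el; move: (sl e el); rewrite !inE => /orP[] /eqP E //;
      rewrite -E el in hr.
  by rewrite (E x) // (E x') // eqxx in xx'.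
case: V => [|w [|? ?]] // in sV W vV none *; move=> _.
have pw := two_legs_bubble W sl; rewrite -sV in R.
have pp (e f : endpoint) : perm_eq [:: e; f] [:: e; f] by [].
have Zl := bubble_zero R W (fl _ hl) (leg_left l r o) (pp _ _) erefl pw.
have Zr := bubble_zero R W (fl _ hr) (leg_right l r o) (perm_swap _ _ [::])
  erefl pw.
have Z e y1 z1 : e \in legs s -> leg (IVertex l r o) e y1 z1 ->
    bracket (phi^~ [:: w]) e y1 z1 s = 0.
  by move=> + L1; inversion L1; subst => // el; rewrite el in ho.
by rewrite (Z _ _ _ xl L) (Z _ _ _ xl' L').
Qed.

Lemma resolve_agree n s v V w W x y z x' y' z' : resolvable n -> size V = n ->
  jacobi_wf (s, v :: V) -> perm_eq (v :: V) (w :: W) -> x \in s -> x' \in s ->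
  leg v x y z -> leg w x' y' z' ->
  bracket (phi^~ V) x y z s = bracket (phi^~ W) x' y' z' s.
Proof.
move=> R sV Wf p xs xs' L L'; have [E | vw] := eqVneq v w.
  move: p L'; rewrite -E perm_cons => p L'; rewrite -(bracket_perm _ _ _ _ p).
  exact: resolve_agree_at R sV Wf xs xs' L L'.
have wV : w \in V.
  have : w \in v :: V by rewrite (perm_mem p) inE eqxx.
  by rewrite inE eq_sym (negbTE vw).
have pV := perm_to_rem wV; set U := rem w V in pV.
have p1 : perm_eq (v :: V) [:: v, w & U] by rewrite perm_cons.
have pW : perm_eq W (v :: U).
  by rewrite -(perm_cons w) -(permPl p) (permPl p1) perm_swap.
have Wf' := Wf; rewrite (wf_perm (perm_refl s) p1) in Wf'.
rewrite (bracket_perm _ _ _ _ pV) (bracket_perm _ _ _ _ pW).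
by apply: (resolve_commute R _ Wf'); rewrite // -sV (perm_size pV).
Qed.

Lemma resolvable_all n : resolvable n.
Proof.
elim: n => // n R s v V x y z; rewrite ltnS leq_eqVlt => /orP[/eqP sV|];
  last exact: R.
move=> W xs L; rewrite {1}/phi /=; case: pselect => [h | []]; last first.
  by exists (bracket (phi_rec (size V) ^~ V) x y z s), v, V, x, y, z.
case: (cid h) => u /= [w [V' [x' [y' [z' [p L' xs' ->]]]]]].
have sV' : size V' = size V by have /perm_size [->] := p.
rewrite -[size V]sV'; symmetry; exact: resolve_agree R sV W p xs xs' L L'.
Qed.

Lemma phi_resolve s v V x y z : jacobi_wf (s, v :: V) -> x \in s ->
  leg v x y z -> phi s (v :: V) = bracket (phi^~ V) x y z s.
Proof. exact: (@resolvable_all (size V).+1). Qed.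

Lemma has_leg s v V : jacobi_wf (s, v :: V) ->
  exists x u y z, [/\ x \in s, u \in v :: V & leg u x y z].
Proof.
move=> W; have := count_legs W.
case El : (legs s) => [|x t] // _.
have xl : x \in legs s by rewrite El inE eqxx.
have [u [y [z [uV L]]]] := legs_vertex W xl.
by exists x, u, y, z; split=> //; move: xl; rewrite mem_legs => /andP[].
Qed.

(** * AS and IHX for [phi] *)

(** At a leg of the vertex itself, exchanging left and right exchanges [y] and [z] in the bracket; a
    leg of another vertex reduces to fewer vertices. *)
Lemma phi_AS s V l r o : jacobi_wf (s, IVertex l r o :: V) ->
  phi s (IVertex r l o :: V) = - phi s (IVertex l r o :: V).
Proof.
have [n] := ubnP (size V); elim: n s V => // n IH s V Vn W.
have [x [u [y [z [xs]]]]] := has_leg W.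
have W' := jacobi_wf_AS W.
rewrite inE => /orP[/eqP-> L | uV L].
  have L' : leg (IVertex r l o) x z y by inversion L; constructor.
  by rewrite (phi_resolve W xs L) (phi_resolve W' xs L') opprB.
have pV := perm_to_rem uV; set U := rem u V in pV.
have p v : perm_eq (v :: V) [:: u, v & U].
  apply: (@perm_trans _ [:: v, u & U]); first by rewrite perm_cons.
  exact: perm_swap.
rewrite !(phi_perm _ (p _)).
rewrite (wf_perm (perm_refl s) (p _)) in W.
rewrite (wf_perm (perm_refl s) (p _)) in W'.
rewrite (phi_resolve W xs L) (phi_resolve W' xs L) /bracket.
have [W1 W2] := wf_resolve W xs L.
have Un : (size U < n)%N by move: Vn; rewrite (perm_size pV).
by rewrite !IH // opprB opprK addrC.
Qed.

(** Removing [v] brings the edge between [v] and [w] to the skeleton with end [x'], so [w] can go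
    next and a double commutator remains. *)
Lemma phi_resolve2 s v w V x y z x' y' z' : jacobi_wf (s, [:: v, w & V]) ->
  x \in s -> leg v x y z -> leg w x' y' z' -> x' \in [:: y; z] ->
  let F u := phi (sub x u s) V in
  phi s [:: v, w & V] =
  F (sub x' [:: y'; z'] [:: y; z]) - F (sub x' [:: z'; y'] [:: y; z]) -
  (F (sub x' [:: y'; z'] [:: z; y]) - F (sub x' [:: z'; y'] [:: z; y])).
Proof.
move=> W xs L L' x'yz F; have [W1 W2] := wf_resolve W xs L.
have [_ yv zv] := leg_vends L.
have x's : x' \notin s.
  apply: (ends_disjoint W (v := v)); first by rewrite inE eqxx.
  have : (x' == y) || (x' == z) by move: x'yz; rewrite !inE.
  by case/orP=> /eqP->.
have x'zy : x' \in [:: z; y] by rewrite (perm_mem (perm_swap z y [::])).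
have M u : x' \in u -> x' \in sub x u s by move=> h; rewrite mem_sub // h.
rewrite (phi_resolve W xs L) /bracket.
rewrite (phi_resolve W1 (M _ x'yz) L') (phi_resolve W2 (M _ x'zy) L').
by rewrite /bracket /F !sub_sub.
Qed.

(** The Jacobi identity for commutators: the six variables are the values at the six orderings of
    three ends, [p] and [q] at the two missing from the left side. *)
Lemma jacobi_sum (M : zmodType) (a b c d p q : M) :
  a - b - (c - d) = (a - p - (q - d)) - ((c - p) - (q - b)).
Proof.
have cancel u v w : u - w - (v - w) = u - v :> M by rewrite subrACA subrr subr0.
have cancel' u v w : u - v - (u - w) = w - v :> M.
  by rewrite subrACA subrr sub0r opprB.
by rewrite [RHS]subrACA cancel cancel' subrACA.
Qed.

Lemma jacobi_sum' (M : zmodType) (a b c d p q : M) :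
  a - b - (c - d) = (a - p - (q - d)) - ((b - q) - (p - c)).
Proof.
rewrite (jacobi_sum a b c d p q); congr (_ - _).
by rewrite -[b - q]opprB -[p - c]opprB opprK addrC.
Qed.

(** The two vertices involved can reach the skeleton only through [x], [y], [z] or [o]. From such a
    leg each of the three diagrams becomes a double commutator of the remaining three ends, and the
    Jacobi identity applies. A leg of any other vertex reduces to fewer vertices. *)
Lemma phi_IHX s V x y z e o :
  jacobi_wf (s, [:: IVertex y z e, IVertex x e o & V]) ->
  phi s [:: IVertex y z e, IVertex x e o & V] =
  phi s [:: IVertex x y e, IVertex e z o & V] -
  phi s [:: IVertex x z e, IVertex e y o & V].
Proof.
have [n] := ubnP (size V); elim: n s V => // n IH s V Vn W.
have [WE WF] := jacobi_wf_IHX W.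
have C (v w : ivertex) : perm_eq [:: v, w & V] [:: w, v & V] := perm_swap v w V.
have [x' [u [y' [z' [xs + L]]]]] := has_leg W.
have [vV wV] : IVertex y z e \in [:: IVertex y z e, IVertex x e o & V] /\
               IVertex x e o \in [:: IVertex y z e, IVertex x e o & V].
  by rewrite !inE !eqxx orbT.
have nHe : Hd e \notin s by apply: (ends_disjoint W wV);
  rewrite !inE eqxx ?orbT.
have nTe : Tl e \notin s by apply: (ends_disjoint W vV);
  rewrite !inE eqxx ?orbT.
have WC := W; rewrite (wf_perm (perm_refl s) (C _ _)) in WC.
have WEC := WE; rewrite (wf_perm (perm_refl s) (C _ _)) in WEC.
have WFC := WF; rewrite (wf_perm (perm_refl s) (C _ _)) in WFC.
have m1 (f g : endpoint) : f \in [:: f; g] by rewrite inE eqxx.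
have m2 (f g : endpoint) : g \in [:: f; g] by rewrite !inE eqxx orbT.
have [xe ye ze] : [/\ (x == e) = false, (y == e) = false & (z == e) = false].
  have := uniq_vends W wV; rewrite /= !inE !end_eqE /= andbT => /negbTE->.
  have D f : Hd f \in vends (IVertex y z e) -> (f == e) = false.
    move/(vends_disjoint W (w := IVertex x e o)); rewrite inE eqxx => /(_ isT).
    by rewrite !inE !end_eqE !negb_or => /and3P[_ _ /negbTE].
  by split=> //; apply: D; rewrite !inE eqxx ?orbT.
rewrite !inE => /or3P[/eqP uE | /eqP uE | uV].
- rewrite uE in L; inversion L; subst.
  + by rewrite xs in nHe.
  + rewrite (phi_resolve2 W xs (leg_left _ _ _) (leg_right _ _ _) (m2 _ _)).
    rewrite (phi_resolve2 WE xs (leg_right _ _ _) (leg_left _ _ _) (m1 _ _)).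
    rewrite (phi_perm _ (C (IVertex x z e) _)).
    rewrite (phi_resolve2 WFC xs (leg_right _ _ _) (leg_out _ _ _) (m2 _ _)).
    by rewrite !sub_cons !eqxx /=; exact: jacobi_sum.
  + rewrite (phi_resolve2 W xs (leg_right _ _ _) (leg_right _ _ _) (m1 _ _)).
    rewrite (phi_perm _ (C (IVertex x y e) _)).
    rewrite (phi_resolve2 WEC xs (leg_right _ _ _) (leg_out _ _ _) (m2 _ _)).
    rewrite (phi_resolve2 WF xs (leg_right _ _ _) (leg_left _ _ _) (m1 _ _)).
    by rewrite !sub_cons !eqxx /=; exact: jacobi_sum.
- rewrite uE in L; inversion L; subst; last by rewrite xs in nTe.
  + rewrite (phi_perm _ (C (IVertex y z e) _)) (phi_perm _ (C (IVertex x y e)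
      _)).
    rewrite (phi_perm _ (C (IVertex x z e) _)).
    rewrite (phi_resolve2 WC xs (leg_out _ _ _) (leg_out _ _ _) (m2 _ _)).
    rewrite (phi_resolve2 WEC xs (leg_out _ _ _) (leg_out _ _ _) (m1 _ _)).
    rewrite (phi_resolve2 WFC xs (leg_out _ _ _) (leg_out _ _ _) (m1 _ _)).
    by rewrite !sub_cons !eqxx ?end_eqE ?xe ?ye ?ze /=; exact: jacobi_sum'.
  + rewrite (phi_perm _ (C (IVertex y z e) _)).
    rewrite (phi_resolve2 WC xs (leg_left _ _ _) (leg_out _ _ _) (m1 _ _)).
    rewrite (phi_resolve2 WE xs (leg_left _ _ _) (leg_left _ _ _) (m2 _ _)).
    rewrite (phi_resolve2 WF xs (leg_left _ _ _) (leg_left _ _ _) (m2 _ _)).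
    by rewrite !sub_cons !eqxx ?end_eqE ?xe ?ye ?ze /=; exact: jacobi_sum'.
have pV := perm_to_rem uV; set U := rem u V in pV.
have p v w : perm_eq [:: v, w & V] [:: u, v, w & U].
  apply: (@perm_trans _ [:: v, w, u & U]); first by rewrite !perm_cons.
  by rewrite (perm_catCA [:: v; w] [:: u]).
rewrite !(phi_perm _ (p _ _)).
rewrite (wf_perm (perm_refl s) (p _ _)) in W.
rewrite (wf_perm (perm_refl s) (p _ _)) in WE.
rewrite (wf_perm (perm_refl s) (p _ _)) in WF.
rewrite (phi_resolve W xs L) (phi_resolve WE xs L) (phi_resolve WF xs L).
rewrite /bracket; have [W1 W2] := wf_resolve W xs L.
have Un : (size U < n)%N by move: Vn; rewrite (perm_size pV).
by rewrite !IH // subrACA.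
Qed.

(** * TC for [phi] *)

Lemma wf_swap s1 s2 a b V : jacobi_wf (s1 ++ [:: Tl a; Tl b] ++ s2, V) ->
  jacobi_wf (s1 ++ [:: Tl b; Tl a] ++ s2, V).
Proof.
suff p : perm_eq (s1 ++ [:: Tl a; Tl b] ++ s2) (s1 ++ [:: Tl b; Tl a] ++ s2).
  by rewrite (wf_perm p (perm_refl V)).
by rewrite perm_cat2l perm_cat2r perm_swap.
Qed.

Lemma legs_perm s t : perm_eq s t -> legs s =i legs t.
Proof. by move=> p e; rewrite !mem_legs !(perm_mem p). Qed.

Lemma internal_partner s V v (A : seq endpoint) e : jacobi_wf (s, V) ->
  {subset legs s <= A} ->
  v \in V -> e \in vends v -> partner e \notin A ->
  exists2 w, w \in V & partner e \in vends w.
Proof.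
move=> W sA vV ev eA; have /wfP[_ C] := W.
have : partner e \in ends s V by rewrite C (mem_ends_vends _ vV ev).
rewrite mem_cat => /orP[es | /flatten_mapP[w wV ew]]; last by exists w.
case/negP: eA; apply: sA; rewrite mem_legs es partnerK.
exact: ends_disjoint W vV ev.
Qed.

(* The tail of b slides across an isolated arrow: 4T moves the head of o along
   the arrow b, and at the head of b the two sides agree by TC. *)
Lemma word_class_bubble_tail s1 s2 o b :
  jacobi_wf (s1 ++ [:: Tl o; Hd o; Tl b] ++ s2, [::]) ->
  word_class (s1 ++ [:: Tl o; Hd o; Tl b] ++ s2) -
  word_class (s1 ++ [:: Hd o; Tl o; Tl b] ++ s2) =
  word_class (s1 ++ [:: Tl b; Tl o; Hd o] ++ s2) -
  word_class (s1 ++ [:: Tl b; Hd o; Tl o] ++ s2).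
Proof.
move=> W; have wd u : perm_eq (s1 ++ [:: Tl o; Hd o; Tl b] ++ s2) u ->
    jacobi_wf (u, [::]).
  by move=> p; rewrite -(wf_perm p (perm_refl [::])).
(* The two orders of the tails, without the head of [o] that 4T moves. *)
set t1 := s1 ++ [:: Tl o; Tl b] ++ s2; set t2 := s1 ++ [:: Tl b; Tl o] ++ s2.
have W1 : jacobi_wf (Hd o :: t1, [::]).
  by apply: wd; apply/permP => p; rewrite /t1 /= !count_cat /=; clear; lia.
have W2 : jacobi_wf (Hd o :: t2, [::]).
  by apply: wd; apply/permP => p; rewrite /t2 /= !count_cat /=; clear; lia.
have bt1 : Tl b \in t1 by rewrite !(mem_cat, inE) eqxx !orbT.
have bt2 : Tl b \in t2 by rewrite !(mem_cat, inE) eqxx !orbT.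
have U1 : uniq t1 by case/andP: (wf_uniq W1).
have [/[!end_eqE] ob _ _ b1 b2] := uniq_mid U1.
have ht1 : Hd b \in t1.
  have /wfP[_ /(_ (Tl b))] := W1; rewrite /ends cats0 /= !inE bt1 orbT.
  by rewrite end_eqE eq_sym (negbTE ob).
have ht2 : Hd b \in t2 by move: ht1; rewrite !(mem_cat, inE).
have E : word_class (sub (Hd b) [:: Hd o; Hd b] t1) -
word_class (sub (Hd b) [:: Hd b; Hd o] t1) =
         word_class (sub (Hd b) [:: Hd o; Hd b] t2) -
         word_class (sub (Hd b) [:: Hd b; Hd o] t2).
  have T w : perm_eq w [:: Hd o; Hd b] ->
      word_class (sub (Hd b) w t1) = word_class (sub (Hd b) w t2).
    move=> p; have : jacobi_wf (sub (Hd b) w t1, [::]).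
      suff p1 : perm_eq (sub (Hd b) w t1) (Hd o :: t1).
        by rewrite (wf_perm p1 (perm_refl [::])).
      apply/permP => q; have := count_sub q (Hd b) w t1.
      have /permP/(_ q) -> := p.
      have -> : count_mem (Hd b) t1 = 1%N by rewrite count_uniq_mem // ht1.
      by clearbody t1; rewrite !mul1n /=; clear; lia.
    by rewrite !sub_cat; exact: word_class_TC.
  by rewrite !T // perm_swap.
have := word_class_4T_sub W1 bt1 ht1; rewrite E -(word_class_4T_sub W2 bt2 ht2).
rewrite !sub_cat !(sub_id _ b1) !sub_cons !(sub_id _ b2) !eqxx.
rewrite end_eqE (negbTE ob) /= => /eqP; rewrite subr_eq => /eqP ->.
have -> : word_class (s1 ++ [:: Hd o; Tl o; Tl b] ++ s2) =
  word_class (s1 ++ [:: Hd o; Tl b; Tl o] ++ s2).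
  have := @word_class_TC (s1 ++ [:: Hd o]) s2 o b; rewrite -!catA; apply;
    apply: wd.
  by apply/permP => p; rewrite /= !count_cat /=; clear; lia.
have -> : word_class (s1 ++ [:: Tl b; Tl o; Hd o] ++ s2) =
  word_class (s1 ++ [:: Tl o; Tl b; Hd o] ++ s2).
  apply: (@word_class_TC s1 (Hd o :: s2) b o); apply: wd.
  by apply/permP => p; rewrite /= !count_cat /=; clear; lia.
by rewrite addrAC [_ - _ - _]addrAC subrr sub0r addrC.
Qed.

(** A lone vertex with a single leg carries a bubble [o]; removing it puts an arrow with adjacent
    ends next to the tail of [b], and [word_class_bubble_tail] moves that tail across. *)
Lemma phi_TC_one_leg s1 s2 a b v
  : jacobi_wf (s1 ++ [:: Tl a; Tl b] ++ s2, [:: v]) ->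
  {subset legs (s1 ++ [:: Tl a; Tl b] ++ s2) <= [:: Tl a]} ->
  Tl a \in legs (s1 ++ [:: Tl a; Tl b] ++ s2) ->
  phi (s1 ++ [:: Tl a; Tl b] ++ s2) [:: v] =
    phi (s1 ++ [:: Tl b; Tl a] ++ s2) [:: v].
Proof.
set s := s1 ++ _; set s' := s1 ++ [:: Tl b; Tl a] ++ s2.
move=> W sl al; have W' : jacobi_wf (s', [:: v]) by exact: wf_swap W.
have [_ [y [z [/[1!inE]/eqP-> L]]]] := legs_vertex W al.
have as_ : Tl a \in s by move: al; rewrite mem_legs => /andP[].
have as' : Tl a \in s' by rewrite !(mem_cat, inE) eqxx !orbT.
have [ab a1 a2 _ _] := uniq_mid (wf_uniq W).
have [W1 W2] := wf_resolve W as_ L.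
rewrite (phi_resolve W as_ L) (phi_resolve W' as' L) /bracket !phi_nil.
move: W1 W2; rewrite !sub_cat !(sub_id _ a1) !sub_cons !(sub_id _ a2) !eqxx [Tl
  b == _]eq_sym (negbTE ab) /=.
have [o pyz] : exists o, perm_eq [:: y; z] [:: Tl o; Hd o].
  have v1 : v \in [:: v] by rewrite inE.
  have [_ yv zv] := leg_vends L.
  have ya : y != Tl a.
    by apply: contraTneq yv => ->; apply: contraTN as_;
      apply: ends_disjoint W v1.
  have : Hd a \notin [:: y; z].
    have := uniq_vends W v1; rewrite -(perm_uniq (leg_perm L)) /=.
    by case/andP.
  rewrite inE negb_or eq_sym => /andP[yHa _].
  have [|w] := internal_partner W sl v1 yv.
    by rewrite inE (can2_eq partnerK partnerK).
  rewrite inE => /eqP->; rewrite -(perm_mem (leg_perm L)) !inE.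
  rewrite (inj_eq (can_inj partnerK)) (negbTE ya) (negbTE (partner_neq y)) /=.
  move/eqP=> <-; case: (y) => o; exists o => //=; exact: perm_swap.
case/perm_eq2: pyz => -[-> ->] W1 W2; first exact: word_class_bubble_tail W1.
by rewrite -[LHS]opprB -[RHS]opprB; congr (- _);
  exact: word_class_bubble_tail W2.
Qed.

(** Both legs end at [v], so [v] feeds a bubble at [w]. *)
Lemma phi_two_legs s a b v w y z : jacobi_wf (s, [:: v; w]) ->
  {subset legs s <= [:: Tl a; Tl b]} -> a != b ->
  Tl a \in s -> leg v (Tl a) y z -> Hd b \in vends v -> phi s [:: v; w] = 0.
Proof.
move=> W sl ab as_ L bv; rewrite (phi_resolve W as_ L).
have [o [pyz pw]] : exists o, perm_eq [:: y; z] [:: Hd b; Tl o] /\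
    perm_eq [:: inl_ w; inr_ w] [:: o; out_ w].
  inversion L; subst; move: bv; rewrite !inE !end_eqE [b == a]eq_sym (negbTE ab)
    /=.
    move/eqP=> E; subst; exists o; split=> //.
    exact: two_legs_bubble W sl.
  rewrite orbF => /eqP E; subst; exists o; split; first exact: perm_swap.
  apply: two_legs_bubble W _ => e /sl; rewrite !inE orbC.
  by [].
exact: bubble_zero (@resolvable_all 1) W as_ L pyz erefl pw.
Qed.

Lemma rename_swap_id o p s : Tl o \notin s -> Hd o \notin s ->
  Tl p \notin s -> Hd p \notin s -> map (rename_endpoint (swap o p)) s = s.
Proof.
move=> to ho tp hp; apply: map_id_in => -[] c cs /=; rewrite swap_neq //.
- by apply: contraNneq to => <-.
- by apply: contraNneq tp => <-.
- by apply: contraNneq ho => <-.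
- by apply: contraNneq hp => <-.
Qed.

Lemma tail_leg v a y z : leg v (Tl a) y z -> exists o r,
  perm_eq (vends v) [:: Hd a; Hd r; Tl o] /\
  ((y = Hd r /\ z = Tl o) \/ (y = Tl o /\ z = Hd r)).
Proof.
move=> L; inversion L; subst; exists o.
  exists r; split; last by left.
  exact: (permEl (perm_catC [:: Tl o] [:: Hd a; Hd r])).
exists l; split; last by right.
exact: (permEl (perm_rev [:: Hd a; Hd l; Tl o])).
Qed.

(* If v and w carry one of the legs each, exchanging their outgoing edges is a
   symmetry that exchanges the two commutators. *)
Lemma phi_TC_two_legs s1 s2 a b v w y z y' z' :
  let s := s1 ++ [:: Tl a; Tl b] ++ s2 in
  jacobi_wf (s, [:: v; w]) -> {subset legs s <= [:: Tl a; Tl b]} ->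
  leg v (Tl a) y z -> leg w (Tl b) y' z' ->
  phi s [:: v; w] = phi (s1 ++ [:: Tl b; Tl a] ++ s2) [:: v; w].
Proof.
move=> s W sl L L'; set s' := s1 ++ [:: Tl b; Tl a] ++ s2.
have W' : jacobi_wf (s', [:: v; w]) by exact: wf_swap W.
have [ab a1 a2 b1 b2] := uniq_mid (wf_uniq W).
have ba : Tl b != Tl a by rewrite eq_sym.
have as_ : Tl a \in s by rewrite !(mem_cat, inE) eqxx !orbT.
have as' : Tl a \in s' by rewrite !(mem_cat, inE) eqxx !orbT.
have vV : v \in [:: v; w] by rewrite inE eqxx.
have wV : w \in [:: v; w] by rewrite !inE eqxx orbT.
have [av yv zv] := leg_vends L; have [bw yw zw] := leg_vends L'.
have bs : Tl b \in s by rewrite !(mem_cat, inE) eqxx !orbT.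
have nb : Tl b \notin [:: y; z].
  apply: contraL bs; rewrite !inE => /orP[]/eqP->; exact: ends_disjoint W vV _.
have nb' : Tl b \notin [:: z; y] by rewrite (perm_mem (perm_swap z y [::])).
have [W1 W2] := wf_resolve W as_ L; have [W1' W2'] := wf_resolve W' as' L.
pose F u := word_class (s1 ++ u ++ s2).
have Db u u' : Tl b \notin u -> sub (Tl b) u' (sub (Tl a) u s) =
  s1 ++ (u ++ u') ++ s2.
  move=> bu; rewrite /s !sub_cat !(sub_id _ a1, sub_id _ a2) eqxx (negbTE ba).
  rewrite !(sub_id _ b1, sub_id _ b2) (sub_id _ bu) sub1E eqxx -!catA.
  by [].
have Db' u u' : Tl b \notin u -> sub (Tl b) u' (sub (Tl a) u s') =
  s1 ++ (u' ++ u) ++ s2.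
  move=> bu; rewrite /s' !sub_cat !(sub_id _ a1, sub_id _ a2) eqxx (negbTE ba).
  rewrite !(sub_id _ b1, sub_id _ b2) (sub_id _ bu) sub1E eqxx -!catA.
  by [].
have M u : Tl b \in sub (Tl a) u s by rewrite mem_sub // ba bs orbT.
have M' u : Tl b \in sub (Tl a) u s'.
  by rewrite mem_sub // ba !(mem_cat, inE) eqxx !orbT.
have E1 : phi s [:: v; w] = F [:: y; z; y'; z'] - F [:: y; z; z'; y'] -
    (F [:: z; y; y'; z'] - F [:: z; y; z'; y']).
  rewrite (phi_resolve W as_ L) /bracket (phi_resolve W1 (M _) L').
  by rewrite (phi_resolve W2 (M _) L') /bracket !phi_nil !Db.
have E2 : phi s' [:: v; w] = F [:: y'; z'; y; z] - F [:: z'; y'; y; z] -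
    (F [:: y'; z'; z; y] - F [:: z'; y'; z; y]).
  rewrite (phi_resolve W' as' L) /bracket (phi_resolve W1' (M' _) L').
  by rewrite (phi_resolve W2' (M' _) L') /bracket !phi_nil !Db'.
rewrite E1 E2.
have nin u e : u \in [:: v; w] -> e \in vends u -> e \notin s1 /\ e \notin s2.
  move=> uV eu; have := ends_disjoint W uV eu.
  by rewrite !mem_cat !negb_or => /and3P[].
(* No end of [o] or [p] lies on the skeleton, so the exchange leaves [s1] and [s2] alone. *)
have K o p : Tl o \in vends v -> Tl p \in vends w ->
  Hd o \in vends v ++ vends w ->
    Hd p \in vends v ++ vends w ->
    forall u, F u = F (map (rename_endpoint (swap o p)) u).
  move=> to tp; rewrite !mem_cat => ho hp u.
  have [no1 no2] : Hd o \notin s1 /\ Hd o \notin s2.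
    by case/orP: ho; [apply: (nin v) | apply: (nin w)].
  have [np1 np2] : Hd p \notin s1 /\ Hd p \notin s2.
    by case/orP: hp; [apply: (nin v) | apply: (nin w)].
  have [to1 to2] := nin _ _ vV to; have [tp1 tp2] := nin _ _ wV tp.
  rewrite /F -[LHS](word_class_rename _ (swap_bij o p)) !map_cat.
  by rewrite (rename_swap_id to1 no1 tp1 np1) (rename_swap_id to2 no2 tp2 np2).
have dvw e : e \in vends v -> e \notin vends w.
  by apply: (vends_disjoint W); rewrite inE.
have P e : e \in vends v ++ vends w -> e \notin [:: Hd a; Hd b] ->
    partner e \in vends v ++ vends w.
  move=> evw eab; have [u uV eu] : exists2 u, u \in [:: v; w] & e \in vends u.
    by move: evw; rewrite mem_cat => /orP[]; [exists v | exists w].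
  have [|u' u'V] := internal_partner W sl uV eu.
    by move: eab; rewrite !inE !(can2_eq partnerK partnerK).
  by rewrite mem_cat; move: u'V; rewrite !inE => /orP[] /eqP-> ->;
    rewrite ?orbT.
(* A renaming that exchanges the two blocks, keeping or reversing the order within both, matches the
   four terms of the two sides. *)
have fin f : (forall u, F u = F (map (rename_endpoint f) u)) ->
    map (rename_endpoint f) [:: y; z; y'; z'] = [:: y'; z'; y; z] \/
    map (rename_endpoint f) [:: y; z; y'; z'] = [:: z'; y'; z; y] ->
    F [:: y; z; y'; z'] - F [:: y; z; z'; y'] -
    (F [:: z; y; y'; z'] - F [:: z; y; z'; y']) =
    F [:: y'; z'; y; z] - F [:: z'; y'; y; z] -
    (F [:: y'; z'; z; y] - F [:: z'; y'; z; y]).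
  move=> Ff E; rewrite (Ff [:: y; z; y'; z']) (Ff [:: y; z; z'; y']).
  rewrite (Ff [:: z; y; y'; z']) (Ff [:: z; y; z'; y']) /=.
  case: E => -[-> -> -> ->]; first exact: subrACA.
  by rewrite !opprB addrACA [RHS]addrACA; congr (_ + _); rewrite addrC.
have na e u : u \in [:: v; w] -> e \in vends u ->
    (e == Tl a) = false /\ (e == Tl b) = false.
  move=> uV eu; have es := ends_disjoint W uV eu.
  by split; apply/negbTE; apply: contraNneq es => ->.
have Tn o : Tl o \in vends v ++ vends w -> (o == a) = false /\ (o == b) = false.
  by rewrite -!Tl_eqE mem_cat => /orP[/(na _ _ vV) | /(na _ _ wV)].
(* The outputs [o] and [p] must fill the two remaining inputs: either each vertex carries a bubble
   or each feeds the other. *)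
have main o r p q : perm_eq (vends v) [:: Hd a; Hd r; Tl o] ->
    perm_eq (vends w) [:: Hd b; Hd q; Tl p] ->
    (forall u, F u = F (map (rename_endpoint (swap o p)) u)) /\
    ((r = o /\ q = p) \/ (r = p /\ q = o)).
  move=> pv pw; have [to tp] : Tl o \in vends v /\ Tl p \in vends w.
    by rewrite (perm_mem pv) (perm_mem pw) !inE !eqxx !orbT.
  have op : (o == p) = false.
    rewrite -Tl_eqE; apply/negbTE; apply: contraNneq (dvw _ to) => ->;
      exact: tp.
  have M2 e : (Hd e \in vends v ++ vends w) =
    [|| e == a, e == r, e == b | e == q].
    by rewrite mem_cat (perm_mem pv) (perm_mem pw) !inE !end_eqE /= !orbF
      -!orbA.
  have to' : Tl o \in vends v ++ vends w by rewrite mem_cat to.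
  have tp' : Tl p \in vends v ++ vends w by rewrite mem_cat tp orbT.
  have ho := P _ to' isT; have hp := P _ tp' isT.
  split; first exact: K.
  move: ho hp; rewrite /= !M2.
  case: (Tn _ to') => -> ->; case: (Tn _ tp') => -> -> /=.
  by move=> /orP[] /eqP oE /orP[] /eqP pE; subst; rewrite ?eqxx in op; auto.
have [o [r [pv yz]]] := tail_leg L; have [p [q [pw yz']]] := tail_leg L'.
have [Fop rq] := main _ _ _ _ pv pw; apply: (fin _ Fop).
move: rq yz yz' => [[-> ->] | [-> ->]] [[-> ->] | [-> ->]] [[-> ->] | [-> ->]].
all: rewrite /= !(swapl, swapr); by [left | right].
Qed.

(** A leg other than the two exchanged tails can be removed on both sides. If there is none, all
    legs are tails, so there are as many vertices as legs: zero, one or two. *)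
Lemma phi_TC s1 s2 V a b : jacobi_wf (s1 ++ [:: Tl a; Tl b] ++ s2, V) ->
  phi (s1 ++ [:: Tl a; Tl b] ++ s2) V = phi (s1 ++ [:: Tl b; Tl a] ++ s2) V.
Proof.
have [n] := ubnP (size V); elim: n s1 s2 V => // n IH s1 s2 V Vn.
set s := s1 ++ _; set s' := s1 ++ [:: Tl b; Tl a] ++ s2.
move=> W; have W' : jacobi_wf (s', V) by exact: wf_swap W.
have ps : perm_eq s s' by rewrite perm_cat2l perm_cat2r perm_swap.
have [ab _ _ _ _] := uniq_mid (wf_uniq W).
have [[x [xl xab]] | none] := pselect (exists x, x \in legs s
  /\ x \notin [:: Tl a; Tl b]).
  have [u [y [z [uV L]]]] := legs_vertex W xl.
  have pV := perm_to_rem uV; set U := rem u V in pV.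
  have xs : x \in s by move: xl; rewrite mem_legs => /andP[].
  have xs' : x \in s' by rewrite -(perm_mem ps).
  have Un : (size U < n)%N by move: Vn; rewrite (perm_size pV).
  rewrite (wf_perm (perm_refl s) pV) in W.
  rewrite (wf_perm (perm_refl s') pV) in W'.
  rewrite !(phi_perm _ pV) (phi_resolve W xs L) (phi_resolve W' xs' L) /bracket.
  have [W1 W2] := wf_resolve W xs L.
  have xba : x \notin [:: Tl b; Tl a] by rewrite (perm_mem (perm_swap _ _
    [::])).
  move: W1 W2; rewrite /s /s' !(sub_cat x _ s1) !(sub_cat x _ [:: Tl _; _] s2).
  by rewrite !(sub_id _ xab, sub_id _ xba) => W1 W2; rewrite !IH.
have sl : {subset legs s <= [:: Tl a; Tl b]}.
  by move=> e el; apply: contrapT => /negP eab; case: none; exists e.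
have sl' : {subset legs s' <= [:: Tl b; Tl a]}.
  by move=> e; rewrite -(legs_perm ps) (perm_mem (perm_swap _ _ [::])) => /sl.
have cnt := count_legs W; have Ul := legs_uniq W.
have pl : perm_eq (legs s) [seq e <- [:: Tl a; Tl b] | e \in legs s].
  apply: uniq_perm => //; first by rewrite filter_uniq //= inE ab.
  by move=> e; rewrite mem_filter andb_idr // => /sl.
move: cnt; rewrite !(permP pl) /=.
case al : (Tl a \in legs s); case bl : (Tl b \in legs s) => /=.
- move=> cV; have {cV} sV : size V = 2%N by move: cV; clear; lia.
  have [v [y [z [vV L]]]] := legs_vertex W al.
  have pV := perm_to_rem vV; case Er : (rem v V) pV => [|w []] pV.
  + by move/perm_size: pV; rewrite sV.
  + rewrite (wf_perm (perm_refl s) pV) in W.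
    rewrite (wf_perm (perm_refl s') pV) in W'.
    have [u [y' [z' [+ L']]]] := legs_vertex W bl.
    rewrite !(phi_perm _ pV) !inE => /orP[] /eqP uE; rewrite uE in L'.
      (* Both tails lead to the same vertex, and both sides vanish. *)
      have [bv _ _] := leg_vends L'.
      have as_ : Tl a \in s by move: al; rewrite mem_legs => /andP[].
      have anb : a != b by rewrite -Tl_eqE.
      rewrite (phi_two_legs W sl anb as_ L bv) (phi_two_legs W' _ anb _ L bv)
        //.
        by move=> e; rewrite -(legs_perm ps) => /sl.
      by rewrite -(perm_mem ps).
    exact: phi_TC_two_legs W sl L L'.
  + by move/perm_size: pV; rewrite sV.
- case: V => [|v []] // in W W' Vn * => _; apply: phi_TC_one_leg => //.
  move=> e el; have := sl e el; rewrite !inE => /orP[//|/eqP E].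
  by rewrite -E el in bl.
- case: V => [|v []] // in W W' Vn * => _; symmetry;
    apply: phi_TC_one_leg => //.
    move=> e el; have := sl' e el; rewrite !inE => /orP[//|/eqP E].
    by rewrite -E (legs_perm ps) el in al.
  by rewrite -(legs_perm ps).
- by case: V => // in W W' Vn * => _; exact: word_class_TC.
Qed.

(** * Linear maps on the quotients, and the descent of [phi] *)

Lemma lquot_lift (R : nzRingType) (V W : lmodType R) (S : V -> Prop)
    (f : {linear V -> W}) : (forall x, S x -> f x = 0) ->
  exists g : {linear lquot S -> W}, forall x, g (lquot_proj S x) = f x.
Proof.
move=> fS; pose g (u : lquot S) := f (repr u).
have gE x : g (lquot_proj S x) = f x.
  apply/eqP; rewrite -subr_eq0 -linearB.
  have /lquot_projP/asboolP[t tS ->] : lquot_proj S (repr (lquot_proj S x)) =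
    lquot_proj S x by exact: reprK.
  rewrite linear_sum big_seq big1 // => p /tS Sp.
  by rewrite linearZ /= fS ?scaler0.
have gl : linear g.
  move=> a u v; have [x <-] := lquot_proj_surj u;
    have [y <-] := lquot_proj_surj v.
  by rewrite -linearZ -linearD !gE linearP.
pose G : {linear lquot S -> W} :=
  HB.pack g (GRing.isLinear.Build R (lquot S) W *:%R g gl).
by exists G.
Qed.

Lemma eq_linear_freeg (R : nzRingType) (K : choiceType) (M : lmodType R)
    (f g : {linear {freeg K / R} -> M}) :
  (forall k, f << k >> = g << k >>) -> f =1 g.
Proof.
move=> fg x; rewrite -[x]freeg_sumE !linear_sum; apply: eq_bigr => k _.
have -> : << coeff k x *g k >> = coeff k x *: << k >> :> {freeg K / R}.
  by apply/eqP/freeg_eqP => y; rewrite coeffZ !coeffU mul1r.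
by rewrite !linearZ /= fg.
Qed.

Definition psi : Dwt -> Aw :=
  fglift (fun d : jacobi_diagram => phi (jacobi_val (repr d)).1 (jacobi_val
    (repr d)).2).
HB.instance Definition _ := GRing.Linear.on psi.

Lemma psi_gen (D : jacobi) :
  psi (jacobi_gen D) = phi (jacobi_val D).1 (jacobi_val D).2.
Proof.
rewrite /psi /jacobi_gen liftU scale1r.
have /eqmodP/asboolP[f bf [<- p]] : repr (\pi_jacobi_diagram D) = D
  %[mod jacobi_diagram] by rewrite reprK.
by rewrite -(phi_perm _ p) phi_rename.
Qed.

Lemma sub_mid x w s1 s2 : uniq (s1 ++ [:: x] ++ s2) ->
  sub x w (s1 ++ [:: x] ++ s2) = s1 ++ w ++ s2.
Proof.
rewrite (perm_uniq (permEl (perm_catCA s1 [:: x] s2))) /= mem_cat negb_or.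
by move=> /andP[/andP[x1 x2] _]; rewrite sub_split.
Qed.

Lemma psi_rel u : rel_wt u -> psi u = 0.
Proof.
have STU s1 s2 v V x y z (D E F : jacobi) : leg v x y z ->
    jacobi_val D = (s1 ++ [:: x] ++ s2, v :: V) ->
    jacobi_val E = (s1 ++ [:: y; z] ++ s2, V) ->
    jacobi_val F = (s1 ++ [:: z; y] ++ s2, V) ->
    psi (jacobi_gen D) = psi (jacobi_gen E) - psi (jacobi_gen F).
  move=> L DE EE FE; have W := valP D; rewrite /= DE in W.
  rewrite !psi_gen DE EE FE /= (phi_resolve W _ L) /bracket.
    by rewrite !sub_mid // (wf_uniq W).
  by rewrite mem_cat inE eqxx orbT.
case=> [s1 s2 V a b D E DE EE | s1 s2 V l r o D E F DE EE FE |
        s1 s2 V l r o D E F DE EE FE | s1 s2 V l r o D E F DE EE FE].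
- have W := valP D; rewrite /= DE in W.
  by rewrite linearB /= !psi_gen DE EE /= phi_TC // subrr.
- by rewrite 2!linearB /= (STU _ _ _ _ _ _ _ _ _ _ (leg_out l r o) DE EE FE)
    subrr.
- by rewrite 2!linearB /= (STU _ _ _ _ _ _ _ _ _ _ (leg_right l r o) DE EE FE)
    subrr.
- by rewrite opprB 2!linearB /= (STU _ _ _ _ _ _ _ _ _ _ (leg_left l r o) DE FE
    EE) subrr.
Qed.

(* The junk value is 0 on codes that are not well formed. *)
Definition jacobi_class s V : Awt :=
  if insub (s, V) is Some D then class_wt (jacobi_gen D) else 0.

Lemma jacobi_classE (D : jacobi) s V : jacobi_val D = (s, V) ->
  jacobi_class s V = class_wt (jacobi_gen D).
Proof. by rewrite /jacobi_class => <-; rewrite valK. Qed.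

Lemma jacobi_of s V : jacobi_wf (s, V) -> exists D : jacobi, jacobi_val D =
  (s, V).
Proof. by move=> W; exists (Jacobi W). Qed.

(** * Classes in [Awt], and the descent of the inclusion *)

Lemma jacobi_class_perm s V V' : jacobi_wf (s, V) -> perm_eq V V' ->
  jacobi_class s V = jacobi_class s V'.
Proof.
move=> W p; have [D DE] := jacobi_of W.
have [E EE] : exists E : jacobi, jacobi_val E = (s, V').
  by apply: jacobi_of; rewrite -(wf_perm (perm_refl s) p).
rewrite (jacobi_classE DE) (jacobi_classE EE) /jacobi_gen;
  congr (class_wt << _ >>).
apply/eqmodP/asboolP; exists id; first by exists id.
by rewrite (eq_map rename_endpoint_id) (eq_map rename_ivertex_id) !map_id DE EE.
Qed.

Lemma jacobi_class_rename f s : bijective f -> jacobi_wf (s, [::]) ->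
  jacobi_class (map (rename_endpoint f) s) [::] = jacobi_class s [::].
Proof.
move=> bf W; have [D DE] := jacobi_of W.
have [E EE] : exists E : jacobi, jacobi_val E =
  (map (rename_endpoint f) s, [::]).
  by apply: jacobi_of; rewrite wf_rename //; exact: bij_inj.
rewrite (jacobi_classE DE) (jacobi_classE EE) /jacobi_gen;
  congr (class_wt << _ >>); symmetry.
by apply/eqmodP/asboolP; exists f; rewrite // DE EE.
Qed.

Lemma jacobi_class_TC s1 s2 a b
  : jacobi_wf (s1 ++ [:: Tl a; Tl b] ++ s2, [::]) ->
  jacobi_class (s1 ++ [:: Tl a; Tl b] ++ s2) [::] =
    jacobi_class (s1 ++ [:: Tl b; Tl a] ++ s2) [::].
Proof.
move=> W; have [D DE] := jacobi_of W; have [E EE] := jacobi_of (wf_swap W).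
rewrite (jacobi_classE DE) (jacobi_classE EE); apply/lquot_projP/mem_span_of;
  exact: wt_TC DE EE.
Qed.

Lemma jacobi_class_resolve s v V x y z : jacobi_wf (s, v :: V) -> x \in s ->
  leg v x y z -> jacobi_class s (v :: V) = bracket (jacobi_class^~ V) x y z s.
Proof.
move=> W xs L; have [W1 W2] := wf_resolve W xs L.
have [s1 [s2 [E _ _ H]]] := sub_splitP (wf_uniq W) xs.
move: W W1 W2; rewrite /bracket !H E -cat1s => W W1 W2.
have [[D DE] [D1 E1] [D2 E2]] :=
  And3 (jacobi_of W) (jacobi_of W1) (jacobi_of W2).
rewrite (jacobi_classE DE) (jacobi_classE E1) (jacobi_classE E2) -raddfB.
apply/lquot_projP/mem_span_of; inversion L; subst.
- exact: wt_STU1 DE E1 E2.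
- by rewrite -[X in _ - X]opprB; exact: wt_STU2l DE E2 E1.
- exact: wt_STU2r DE E1 E2.
Qed.

Lemma fresh_name (s : seq endpoint) : exists l, Tl l \notin s /\ Hd l \notin s.
Proof.
pose name e := match e with Tl a => a | Hd a => a end.
have le e : e \in s -> (name e <= sumn (map name s))%N.
  elim: s => //= f s IH; rewrite inE => /orP[/eqP-> | /IH];
    first exact: leq_addr.
  by move/leq_trans; apply; exact: leq_addl.
by exists (sumn (map name s)).+1; split; apply/negP => /le; rewrite ltnn.
Qed.

Lemma sub_self x s : sub x [:: x] s = s.
Proof. by elim: s => //= e s IH; rewrite sub_cons IH; case: eqP => [->|]. Qed.

(* Both sides remove the vertex at which b meets the arrow a from a diagram whose
   tail there carries the fresh name l. *)
Lemma jacobi_class_4T_sub t a b : jacobi_wf (Hd b :: t, [::]) -> Tl a \in t ->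
  Hd a \in t ->
  jacobi_class (sub (Tl a) [:: Hd b; Tl a] t) [::] - jacobi_class (sub (Tl a)
    [:: Tl a; Hd b] t) [::] =
  - (jacobi_class (sub (Hd a) [:: Hd b; Hd a] t) [::] -
     jacobi_class (sub (Hd a) [:: Hd a; Hd b] t) [::]).
Proof.
move=> W ta ha; have [l [+ +]] := fresh_name (Hd b :: t).
rewrite !inE !negb_or end_eqE => /andP[_ tl] /andP[lb hl].
have U : uniq t by case/andP: (wf_uniq W).
have hb : Hd b \notin t by case/andP: (wf_uniq W).
have la : l != a by apply: contraNneq tl => ->.
have ba : b != a by apply: contraNneq hb => ->.
set s := sub (Tl a) [:: Tl l] t; set v := IVertex l b a.
have Ws : jacobi_wf (s, [:: v]).
  have p : perm_eq (ends s [:: v]) [:: Tl l, Hd l & Hd b :: t].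
    apply/permP => q; rewrite /ends count_cat /=.
    have := count_sub q (Tl a) [:: Tl l] t.
    have -> : count_mem (Tl a) t = 1%N by rewrite count_uniq_mem // ta.
    by rewrite -/s !mul1n /=; clearbody s; clear; lia.
  have /wfP[U' C] := W; rewrite /ends cats0 in U' C.
  apply/wfP; rewrite (perm_uniq p); split.
    by rewrite cons_uniq cons_uniq !inE !end_eqE /= (negbTE tl) (negbTE lb)
      (negbTE hl).
  move=> e; rewrite !(perm_mem p); move: (Hd b :: t) C => u C.
  by rewrite !in_cons C !(can2_eq partnerK partnerK) /= orbCA.
have sl : Tl l \in s by rewrite mem_sub // inE eqxx.
have sa : Hd a \in s by rewrite mem_sub // ha orbT.
have LL := leg_left l b a; have LO := leg_out l b a.
have [W1 W2] := wf_resolve Ws sa LO.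
have := jacobi_class_resolve Ws sl LL; rewrite (jacobi_class_resolve Ws sa LO)
  /bracket.
rewrite /s !(sub_sub _ _ _ tl) !sub1E eqxx -/s => <-.
(* Removal at [Tl l] restores the name [a], but removal at [Hd a] keeps [l]; exchanging [l] and [a]
   brings the latter back to words over [t]. *)
have H c d : jacobi_wf (sub (Hd a) [:: Hd c; Hd d] s, [::]) ->
    jacobi_class (sub (Hd a) [:: Hd c; Hd d] s) [::] =
    jacobi_class (sub (Hd a) [:: Hd (swap l a c); Hd (swap l a d)] t) [::].
  move=> Wc; rewrite -(jacobi_class_rename (swap_bij l a) Wc) map_rename_sub;
    last first.
    exact: bij_inj (swap_bij l a).
  rewrite /= swapr map_rename_swap.
  - rewrite /s (sub_sub _ _ _ tl) sub1E eqxx sub_self (sub_sub _ _ _ hl) sub1E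
      eqxx.
    by [].
  - by apply: sub_notin.
  - by rewrite mem_sub // inE end_eqE eq_sym (negbTE la) eqxx.
rewrite (H _ _ W1) (H _ _ W2) swapl (swap_neq _ ba) 1?eq_sym //.
by rewrite opprB.
Qed.

Lemma class_wt_iota_rel u : rel_w u -> class_wt (iota_vw u) = 0.
Proof.
pose i x := class_wt (iota_vw x).
have iB : {morph i : x y / x - y} by move=> x y; rewrite /i 2!linearB.
have iD : {morph i : x y / x + y} by move=> x y; rewrite /i 2!linearD.
have iE (D : arrow_word) : i (arrow_gen D) = jacobi_class (skeleton D) [::].
  by rewrite /i iota_vw_gen; symmetry; exact: jacobi_classE.
have Wd (D : arrow_word) : jacobi_wf (skeleton D, [::]).
  by rewrite wf_arrow; exact: (valP D).
rewrite -/(i u); case=> [s1 s2 a b D E DE EE | s1 s2 s3 a b x y D1 D2 D3 D4 pxy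
  E1 E2 E3 E4].
  rewrite iB !iE DE EE jacobi_class_TC ?subrr // -DE; exact: Wd.
rewrite iB !iD !iE; apply/eqP.
rewrite opprD addrACA addr_eq0; apply/eqP; rewrite E1 E2 E3 E4.
set t := s1 ++ [:: x] ++ s2 ++ [:: y] ++ s3.
have Wt : jacobi_wf (Hd b :: t, [::]).
  have p : perm_eq (Hd b :: t) (skeleton D1).
    by rewrite E1 /t; apply/permP => q; rewrite /= !count_cat /= !count_cat /=;
      clear; lia.
  by rewrite (wf_perm p (perm_refl [::])).
have U : uniq t by case/andP: (wf_uniq Wt).
have Hx w : s1 ++ w ++ s2 ++ [:: y] ++ s3 = sub x w t by rewrite /t sub_mid.
have Hy w : s1 ++ [:: x] ++ s2 ++ w ++ s3 = sub y w t.
  rewrite /t; have := @sub_mid y w (s1 ++ [:: x] ++ s2) s3; rewrite -!catA => ->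
    //.
have [xt yt] : x \in t /\ y \in t by rewrite !(mem_cat, inE) !eqxx !orbT.
rewrite !Hx !Hy; case/perm_eq2: pxy => -[xE yE]; rewrite xE yE in xt yt *.
  exact: jacobi_class_4T_sub.
by rewrite (jacobi_class_4T_sub Wt) // opprK.
Qed.

(** * The isomorphism *)

(** By STU, classes in [Awt] obey the same removal rule as [phi]. This yields one of the two inverse
    laws and transports AS and IHX from [phi] to [Awt]. *)
Lemma lift_phi (i : {linear Aw -> Awt}) :
  (forall x, i (class_w x) = class_wt (iota_vw x)) ->
  forall s V, jacobi_wf (s, V) -> i (phi s V) = jacobi_class s V.
Proof.
move=> iE s V; have [n] := ubnP (size V); elim: n s V => // n IH s [|v V] Vn W.
  have [D DE] := word_of W; rewrite phi_nil -DE word_classE iE iota_vw_gen.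
  by symmetry; apply: jacobi_classE.
have [x [u [y [z [xs uV L]]]]] := has_leg W.
have pV := perm_to_rem uV; set U := rem u _ in pV.
rewrite (phi_perm _ pV) (jacobi_class_perm W pV).
have Wu := W; rewrite (wf_perm (perm_refl s) pV) in Wu.
have [W1 W2] := wf_resolve Wu xs L.
have Un : (size U < n)%N by move: Vn; rewrite (perm_size pV).
by rewrite (phi_resolve Wu xs L) (jacobi_class_resolve Wu xs L) /bracket linearB
  !IH.
Qed.

Theorem theorem3p14 :
  (exists iota_bar : {linear Aw -> Awt},
     (forall x : Dv, iota_bar (class_w x) = class_wt (iota_vw x)) /\
     bijective iota_bar)
  /\
  (* AS *)
  (forall (s : seq endpoint) (V : seq ivertex) (l r o : nat) (D E : jacobi),
     jacobi_val D = (s, IVertex l r o :: V) ->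
     jacobi_val E = (s, IVertex r l o :: V) ->
     class_wt (jacobi_gen E) = - class_wt (jacobi_gen D))
  /\
  (* IHX: [x,[y,z]] = [[x,y],z] - [[x,z],y]; e is the edge joining the two
     vertices and o the outgoing edge *)
  (forall (s : seq endpoint) (V : seq ivertex) (x y z e o : nat)
          (D E F : jacobi),
     jacobi_val D = (s, [:: IVertex y z e, IVertex x e o & V]) ->
     jacobi_val E = (s, [:: IVertex x y e, IVertex e z o & V]) ->
     jacobi_val F = (s, [:: IVertex x z e, IVertex e y o & V]) ->
     class_wt (jacobi_gen D) =
       class_wt (jacobi_gen E) - class_wt (jacobi_gen F)).
Proof.
have [i iE] := lquot_lift (f := class_wt \o iota_vw) class_wt_iota_rel.
have [j jE] := lquot_lift psi_rel.
have iphi (D : jacobi) : i (phi (jacobi_val D).1 (jacobi_val D).2) =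
    class_wt (jacobi_gen D).
  have W := valP D; case DE : (jacobi_val D) => [s V]; rewrite /= DE in W.
  by rewrite /= (lift_phi iE W) (jacobi_classE DE).
split; last split.
(* One composite is checked on arrow diagrams, where [phi] has nothing to remove, the other on
   w-Jacobi diagrams by [iphi]. *)
- exists i; split=> //; exists j => u.
    have [x <-] := lquot_proj_surj u; rewrite -/(class_w x) iE [LHS]jE.
    apply: (eq_linear_freeg (f := psi \o iota_vw) (g := class_w)) x => d.
    rewrite -[d]reprK -/(arrow_gen _) /= iota_vw_gen psi_gen.
    by rewrite phi_nil word_classE.
  have [x <-] := lquot_proj_surj u; rewrite jE.
  apply: (eq_linear_freeg (f := i \o psi) (g := class_wt)) x => d.
  by rewrite -[d]reprK -/(jacobi_gen _) /= psi_gen iphi.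
- move=> s V l r o D E DE EE; have W := valP D; rewrite /= DE in W.
  by rewrite -!iphi DE EE /= phi_AS // linearN.
- move=> s V x y z e o D E F DE EE FE; have W := valP D; rewrite /= DE in W.
  by rewrite -!iphi DE EE FE /= phi_IHX // linearB.
Qed.
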